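(* Let $\Bbbk$ be a commutative ring and fix $n\in\mathbb{N}$. Consider the functors $\Psi_n\colon\mathcal{P}ar(n)\to\mathcal{H}_{\uparrow\downarrow}(n)$, $\Omega_n\colon\mathcal{H}_{\uparrow\downarrow}(n)\to S_n\text{-mod}$ and $\Phi_n\colon\mathcal{P}ar(n)\to S_n\text{-mod}$. The morphisms $\beta_k$, $k\in\mathbb{N}$, give a natural isomorphism of functors $\Omega_n\circ\Psi_n\cong\Phi_n$.
   Context: Partition category. For $t\in\Bbbk$ and $m,\ell\in\mathbb{N}$, a partition of type $\binom{\ell}{m}$, written $D\colon m\to\ell$, is a set partition of $\{1,\dots,m,1',\dots,\ell'\}$; its parts are called blocks. It is drawn with bottom vertices $1,\dots,m$ and top vertices $1',\dots,\ell'$, numbered from right to left. For $D'\colon m\to\ell$ and $D\colon\ell\to k$, stack $D$ on top of $D'$, identifying the bottom vertices of $D$ with the top vertices of $D'$; let $\alpha(D,D')$ be the number of connected components containing only middle vertices, and let $D\star D'\colon m\to k$ be the partition in which vertices are in the same block iff they are connected in the stacked diagram. $\mathcal{P}ar(t)$ is the strict $\Bbbk$-linear monoidal category with objects $m\in\mathbb{N}$, with $\mathrm{Hom}(m,\ell)$ the free $\Bbbk$-module on partitions of type $\binom{\ell}{m}$, composition $D\circ D'=t^{\alpha(D,D')}D\star D'$ extended bilinearly, and tensor product given by addition on objects and horizontal juxtaposition on morphisms. It is generated as a $\Bbbk$-linear monoidal category by the object $1$ and the morphisms $\mu\colon2\to1$, $\delta\colon1\to2$, $\eta\colon0\to1$,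 $\varepsilon\colon1\to0$ (the unique one-block partitions of these types) and $s\colon2\to2$ with blocks $\{1,2'\},\{2,1'\}$. Heisenberg category. $\mathcal{H}$ is the strict $\Bbbk$-linear monoidal category with unit $\mathbb{1}$ generated by objects $\uparrow,\downarrow$ (juxtaposition is tensor product) and morphisms $X\colon\uparrow\uparrow\to\uparrow\uparrow$, $c\colon\mathbb{1}\to\downarrow\uparrow$, $d\colon\uparrow\downarrow\to\mathbb{1}$, $c'\colon\mathbb{1}\to\uparrow\downarrow$, $d'\colon\downarrow\uparrow\to\mathbb{1}$, subject to $X\circ X=1_{\uparrow\uparrow}$; $(X\otimes1_\uparrow)(1_\uparrow\otimes X)(X\otimes1_\uparrow)=(1_\uparrow\otimes X)(X\otimes1_\uparrow)(1_\uparrow\otimes X)$; $(d\otimes1_\uparrow)(1_\uparrow\otimes c)=1_\uparrow$; $(1_\downarrow\otimes d)(c\otimes1_\downarrow)=1_\downarrow$; $l\circ r=1_{\uparrow\downarrow}$; $r\circ l=1_{\downarrow\uparrow}-c\circ d'$; $(d'\otimes1_\uparrow)(1_\downarrow\otimes X)(c\otimes1_\uparrow)=0$; $d'\circ c=1_{\mathbb{1}}$; where $l=(d'\otimes1_\uparrow\otimes1_\downarrow)(1_\downarrow\otimes X\otimes1_\downarrow)(1_\downarrow\otimes1_\uparrow\otimes c')\colon\downarrow\uparrow\to\uparrow\downarrow$ and $r=(1_\downarrow\otimes1_\uparrow\otimes d)(1_\downarrow\otimes X\otimes1_\downarrow)(c\otimes1_\uparrow\otimes1_\downarrow)\colon\uparrow\downarrow\to\downarrow\uparrow$.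 Put $Y=(d'\otimes1_\downarrow\otimes1_\downarrow)(1_\downarrow\otimes l\otimes1_\downarrow)(1_\downarrow\otimes1_\downarrow\otimes c')\colon\downarrow\downarrow\to\downarrow\downarrow$. $\mathcal{H}_{\uparrow\downarrow}$ is the full monoidal subcategory with objects $(\uparrow\downarrow)^k$, $k\ge0$; the clockwise bubble $d\circ c'$ is strictly central in it, and $\mathcal{H}_{\uparrow\downarrow}(t)$ is the quotient of $\mathcal{H}_{\uparrow\downarrow}$ by the relation $d\circ c'=t\,1_{\mathbb{1}}$. The functor $\Psi_t\colon\mathcal{P}ar(t)\to\mathcal{H}_{\uparrow\downarrow}(t)$ is the strict $\Bbbk$-linear monoidal functor with $k\mapsto(\uparrow\downarrow)^k$, $\mu\mapsto1_\uparrow\otimes d'\otimes1_\downarrow$, $\delta\mapsto1_\uparrow\otimes c\otimes1_\downarrow$, $\eta\mapsto c'$, $\varepsilon\mapsto d$, $s\mapsto(1_\uparrow\otimes r\otimes1_\downarrow)\circ(X\otimes Y)\circ(1_\uparrow\otimes l\otimes1_\downarrow)+1_\uparrow\otimes(c\circ d')\otimes1_\downarrow$. $\Psi_n$ is the case $t=n$ (image of $n$ in $\Bbbk$). The functor $\Phi_n$. Let $V=\Bbbk^n$ be the permutation representation of $S_n$ with basis $v_1,\dots,v_n$, and $\mathbf{1}_n$ the one-dimensional trivial $S_n$-module. $\Phi_n\colon\mathcal{P}ar(n)\to S_n\text{-mod}$ is the strong $\Bbbk$-linear monoidal functor with $\Phi_n(1)=V$ (so $\Phi_n(k)=V^{\otimes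 k}$), $\Phi_n(\mu)(v_i\otimes v_j)=\delta_{i,j}v_i$, $\Phi_n(\eta)(1)=\sum_{i=1}^nv_i$, $\Phi_n(\delta)(v_i)=v_i\otimes v_i$, $\Phi_n(\varepsilon)(v_i)=1$, $\Phi_n(s)(v_i\otimes v_j)=v_j\otimes v_i$. The functor $\Omega_n$. $S_0$ is the trivial group, $\Bbbk S_0=\Bbbk$. For $0\le m,k\le n$, ${}_k(n)_m$ denotes $\Bbbk S_n$ as an $(S_k,S_m)$-bimodule, using the standard embeddings; a subscript equal to $n$ is omitted; juxtaposition of bimodules means tensor product over the indicated $\Bbbk S_m$, written $\otimes_m$ (e.g. $(n)_{n-1}(n)=\Bbbk S_n\otimes_{n-1}\Bbbk S_n$). Let $s_i=(i\;i{+}1)$ and $g_i=s_is_{i+1}\cdots s_{n-1}$ for $1\le i\le n$ ($g_n=1$), left coset representatives of $S_{n-1}$ in $S_n$. There is a strong $\Bbbk$-linear monoidal functor $\Theta\colon\mathcal{H}\to\prod_{m\in\mathbb{N}}\bigl(\bigoplus_{n\in\mathbb{N}}(S_n,S_m)\text{-bimod}\bigr)$ (with tensor product of bimodules, where the product of an $(S_n,S_m)$- and an $(S_k,S_\ell)$-bimodule is $0$ if $m\ne k$) given by $\Theta(\uparrow)=((n)_{n-1})_{n\ge1}$, $\Theta(\downarrow)=({}_{n-1}(n))_{n\ge1}$ and, on generating morphisms, with components $\Theta(X)\colon(n)_{n-2}\to(n)_{n-2}$, $g\mapsto gs_{n-1}$ ($n\ge2$); $\Theta(c)\colon(n-1)\to{}_{n-1}(n)_{n-1}$,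 $g\mapsto g$ ($n\ge1$); $\Theta(d)\colon(n)_{n-1}(n)\to(n)$, $g\otimes h\mapsto gh$ ($n\ge1$); $\Theta(c')\colon(n)\to(n)_{n-1}(n)$, $g\mapsto\sum_{i=1}^ng_i\otimes g_i^{-1}g$ ($n\ge1$); $\Theta(d')\colon{}_{n-1}(n)_{n-1}\to(n-1)$, $g\mapsto g$ if $g\in S_{n-1}$ and $g\mapsto0$ if $g\in S_n\setminus S_{n-1}$ ($n\ge1$). On $\mathcal{H}_{\uparrow\downarrow}$ the image of $\Theta$ consists of families of $(S_m,S_m)$-bimodules, $m\in\mathbb{N}$. Composing with $-\otimes_n\mathbf{1}_n$ (take the $(S_n,S_n)$-component and tensor on the right over $\Bbbk S_n$ with $\mathbf{1}_n$) gives a functor $\mathcal{H}_{\uparrow\downarrow}\to S_n\text{-mod}$ that factors through $\mathcal{H}_{\uparrow\downarrow}(n)$; the resulting ($\Bbbk$-linear, not monoidal) functor is $\Omega_n\colon\mathcal{H}_{\uparrow\downarrow}(n)\to S_n\text{-mod}$. The maps $\beta_k$. Let $B=\Bbbk S_n$ as an $(S_n,S_{n-1})$-bimodule and $B^k=B\otimes_{n-1}\cdots\otimes_{n-1}B$ ($k$ factors). Via the canonical identifications $\Bbbk S_n\otimes_n\Bbbk S_n=\Bbbk S_n$ and $\Bbbk S_n\otimes_n\mathbf{1}_n=\mathbf{1}_n$, one has $\Omega_n((\uparrow\downarrow)^k)=B^k\otimes_{n-1}\mathbf{1}_{n-1}$ for $k\ge 1$. The isomorphism of $S_n$-modules $\beta_k\colon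 V^{\otimes k}\to B^k\otimes_{n-1}\mathbf{1}_{n-1}$ is given by $v_{i_k}\otimes\cdots\otimes v_{i_1}\mapsto g_{i_k}\otimes g_{i_k}^{-1}g_{i_{k-1}}\otimes\cdots\otimes g_{i_2}^{-1}g_{i_1}\otimes1$ for $1\le i_1,\dots,i_k\le n$. For $k=0$, $\Omega_n(\mathbb{1})=\mathbf{1}_n$ and $\beta_0$ is the identity of $\mathbf{1}_n$. (If $n=0$ and $k\ge1$, both modules are $0$.) *)

(* Defs.v *)
From HB Require Import structures.
From mathcomp Require Import all_boot all_order all_algebra all_fingroup.
From mathcomp Require Import boolp.

Set Implicit Arguments.
Unset Strict Implicit.
Unset Printing Implicit Defensive.

Import GRing.Theory.
Local Open Scope ring_scope.
Local Open Scope quotient_scope.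

(* The operations of an R-linear category whose hom-sets are setoids: [heq]  *)
(* is the equality of morphisms.  The laws hold in all the instances below;  *)
(* functors and natural transformations do not refer to them.                *)
Record lincat (R : comPzRingType) := LinCat {
  ob :> Type;
  hom : ob -> ob -> Type;
  heq : forall a b, hom a b -> hom a b -> Prop;
  idm : forall a, hom a a;
  comp : forall a b c, hom b c -> hom a b -> hom a c;
  addm : forall a b, hom a b -> hom a b -> hom a b;
  scalem : forall a b, R -> hom a b -> hom a b }.

Arguments hom {R} l a b.
Arguments heq {R l a b} f g.
Arguments idm {R l} a.
Arguments comp {R l a b c} f g.
Arguments addm {R l a b} f g.
Arguments scalem {R l a b} x f.

Record linfunctor (R : comPzRingType) (C D : lincat R) (F : C -> D) :=
  LinFunctor {
  fmap :> forall a b, hom C a b -> hom D (F a) (F b);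
  fmap_eq : forall a b (f g : hom C a b), heq f g -> heq (fmap f) (fmap g);
  fmap_id : forall a, heq (fmap (idm a)) (idm (F a));
  fmap_comp : forall a b c (f : hom C b c) (g : hom C a b),
    heq (fmap (comp f g)) (comp (fmap f) (fmap g));
  fmap_add : forall a b (f g : hom C a b),
    heq (fmap (addm f g)) (addm (fmap f) (fmap g));
  fmap_scale : forall a b x (f : hom C a b),
    heq (fmap (scalem x f)) (scalem x (fmap f)) }.

Definition is_iso (R : comPzRingType) (C : lincat R) (a b : C)
    (f : hom C a b) : Prop :=
  exists g : hom C b a, heq (comp g f) (idm a) /\ heq (comp f g) (idm b).

(* [beta] is a natural isomorphism from G to the composite of P, then O.     *)
Definition natural_iso (R : comPzRingType) (C C' D : lincat R)
    (G0 : C -> D) (P0 : C -> C') (O0 : C' -> D)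
    (G : linfunctor G0) (O : linfunctor O0) (P : linfunctor P0)
    (beta : forall a, hom D (G0 a) (O0 (P0 a))) : Prop :=
  (forall a b (f : hom C a b),
     heq (comp (O _ _ (P _ _ f)) (beta a)) (comp (beta b) (G _ _ f))) /\
  (forall a, is_iso (beta a)).

(* Vertices of a diagram m -> l: bottom (inl) and top (inr), listed from     *)
(* left to right.                                                            *)
Definition vertex (m l : nat) : finType := ('I_m + 'I_l)%type.

Definition diagram (m l : nat) : finType :=
  {P : {set {set vertex m l}} | partition P [set: vertex m l]}.

Section Generated.
Variables (T : finType) (e : rel T).

Definition symclos : rel T := fun x y => e x y || e y x.

Definition components : {set {set T}} :=
  equivalence_partition (connect symclos) [set: T].

Lemma components_partition : partition components [set: T].
Proof.
apply: equivalence_partitionP => x y z _ _ _; split; first exact: connect0.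
have sym : connect_sym symclos.
  by apply: sym_connect_sym => u v; rewrite /symclos orbC.
by move=> xy; apply: (same_connect sym).
Qed.
End Generated.

(* The partition into the classes of the equivalence generated by [e]. *)
Definition diagram_of m l (e : rel (vertex m l)) : diagram m l :=
  Sub (components e) (components_partition e).

Definition same_block m l (D : diagram m l) : rel (vertex m l) :=
  fun x y => y \in pblock (val D) x.

Definition image_rel (S T : finType) (f : S -> T) (r : rel S) : rel T :=
  fun x y => [exists u, exists v, [&& r u v, x == f u & y == f v]].

Section Stack.
Variables (m l k : nat) (D : diagram l k) (D' : diagram m l).

(* Vertices of the stacked diagram: bottom, middle, top. *)
Definition stack_vertex : finType := ('I_m + 'I_l + 'I_k)%type.

Definition lower (x : vertex m l) : stack_vertex := inl x.
Definition upper (x : vertex l k) : stack_vertex :=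
  match x with inl i => inl (inr i) | inr j => inr j end.
Definition outer (x : vertex m k) : stack_vertex :=
  match x with inl i => inl (inl i) | inr j => inr j end.

Definition stack : rel stack_vertex := fun x y =>
  image_rel lower (same_block D') x y || image_rel upper (same_block D) x y.

Definition middle : {set stack_vertex} := [set inl (inr i) | i : 'I_l].

Definition alpha : nat := #|[set C in components stack | C \subset middle]|.

Definition star : diagram m k :=
  diagram_of (fun x y => connect (symclos stack) (outer x) (outer y)).
End Stack.

Definition id_diagram m : diagram m m :=
  diagram_of (fun x y => match x, y with
                         | inl i, inr j => i == j | _, _ => false end).

Definition one_block m l : diagram m l := diagram_of (fun _ _ => true).

Definition swap_diagram : diagram 2 2 :=
  diagram_of (fun x y => match x, y with
                         | inl i, inr j => j == rev_ord i | _, _ => false end).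

(* Horizontal juxtaposition, D on the left of D'. *)
Definition lvertex m l m' l' (x : vertex m l) : vertex (m + m') (l + l') :=
  match x with inl i => inl (lshift m' i) | inr j => inr (lshift l' j) end.
Definition rvertex m l m' l' (x : vertex m' l') : vertex (m + m') (l + l') :=
  match x with inl i => inl (rshift m i) | inr j => inr (rshift l j) end.

Definition juxtapose m l m' l' (D : diagram m l) (D' : diagram m' l') :
    diagram (m + m') (l + l') :=
  diagram_of (fun x y => image_rel (@lvertex m l m' l') (same_block D) x y ||
                         image_rel (@rvertex m l m' l') (same_block D') x y).

Section Par.
Variables (R : comPzRingType) (t : R).

Definition par_hom m l : lmodType R := {ffun diagram m l -> R^o}.

Definition pbasis m l (D : diagram m l) : par_hom m l :=
  [ffun E => (E == D)%:R].

Definition par_comp m l k (f : par_hom l k) (g : par_hom m l) : par_hom m k :=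
  \sum_(D : diagram l k) \sum_(D' : diagram m l)
    (f D * g D' * t ^+ alpha D D') *: pbasis (star D D').

Definition par_tens m l m' l' (f : par_hom m l) (g : par_hom m' l') :
    par_hom (m + m') (l + l') :=
  \sum_(D : diagram m l) \sum_(D' : diagram m' l')
    (f D * g D') *: pbasis (juxtapose D D').

Definition Par : lincat R :=
  @LinCat R nat par_hom (fun _ _ => eq) (fun m => pbasis (id_diagram m))
    par_comp (fun _ _ f g => f + g) (fun _ _ x f => x *: f).

Definition par_mu : par_hom 2 1 := pbasis (one_block 2 1).
Definition par_delta : par_hom 1 2 := pbasis (one_block 1 2).
Definition par_eta : par_hom 0 1 := pbasis (one_block 0 1).
Definition par_epsilon : par_hom 1 0 := pbasis (one_block 1 0).
Definition par_s : par_hom 2 2 := pbasis swap_diagram.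
End Par.

Arguments par_mu {R}.
Arguments par_delta {R}.
Arguments par_eta {R}.
Arguments par_epsilon {R}.
Arguments par_s {R}.

Variant arrow := up | down.
Definition word := seq arrow.

(* Formal morphisms; a morphism of the Heisenberg category is a formal       *)
(* morphism up to [Heq] below.                                               *)
Inductive hmor (R : comPzRingType) : word -> word -> Type :=
| Hid a : hmor R a a
| Hcomp a b c : hmor R b c -> hmor R a b -> hmor R a c
| Htens a b a' b' : hmor R a b -> hmor R a' b' -> hmor R (a ++ a') (b ++ b')
| Hzero a b : hmor R a b
| Hadd a b : hmor R a b -> hmor R a b -> hmor R a b
| Hscale a b : R -> hmor R a b -> hmor R a b
| HX : hmor R [:: up; up] [:: up; up]
| Hc : hmor R [::] [:: down; up]
| Hd : hmor R [:: up; down] [::]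
| Hc' : hmor R [::] [:: up; down]
| Hd' : hmor R [:: down; up] [::].

Arguments Hid {R} a.
Arguments Hzero {R a b}.
Arguments HX {R}.
Arguments Hc {R}.
Arguments Hd {R}.
Arguments Hc' {R}.
Arguments Hd' {R}.

Declare Scope heis_scope.
Delimit Scope heis_scope with H.
Bind Scope heis_scope with hmor.
Notation "f ∘ g" := (Hcomp f g)
  (at level 45, left associativity) : heis_scope.
Notation "f ** g" := (Htens f g)
  (at level 40, left associativity) : heis_scope.
Notation "f + g" := (Hadd f g) : heis_scope.
Notation "x *: f" := (Hscale x f) : heis_scope.
Notation "1↑" := (Hid [:: up]) : heis_scope.
Notation "1↓" := (Hid [:: down]) : heis_scope.

Definition hcast (R : comPzRingType) (a a' b b' : word) (ea : a = a')
    (eb : b = b') (f : hmor R a b) : hmor R a' b' :=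
  ecast z (hmor R a' z) eb (ecast z (hmor R z b) ea f).

Section Heis.
Variable R : comPzRingType.
Local Open Scope heis_scope.

Definition Hl : hmor R [:: down; up] [:: up; down] :=
  (Hd' ** 1↑ ** 1↓) ∘ (1↓ ** HX ** 1↓) ∘ (1↓ ** 1↑ ** Hc').

Definition Hr : hmor R [:: up; down] [:: down; up] :=
  (1↓ ** 1↑ ** Hd) ∘ (1↓ ** HX ** 1↓) ∘ (Hc ** 1↑ ** 1↓).

Definition HY : hmor R [:: down; down] [:: down; down] :=
  (Hd' ** 1↓ ** 1↓) ∘ (1↓ ** Hl ** 1↓) ∘ (1↓ ** 1↓ ** Hc').

Inductive Heq : forall a b, hmor R a b -> hmor R a b -> Prop :=
| Heq_refl a b (f : hmor R a b) : Heq f f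
| Heq_sym a b (f g : hmor R a b) : Heq f g -> Heq g f
| Heq_trans a b (f g h : hmor R a b) : Heq f g -> Heq g h -> Heq f h
| Heq_comp a b c (f f' : hmor R b c) (g g' : hmor R a b) :
    Heq f f' -> Heq g g' -> Heq (f ∘ g) (f' ∘ g')
| Heq_tens a b a' b' (f f' : hmor R a b) (g g' : hmor R a' b') :
    Heq f f' -> Heq g g' -> Heq (f ** g) (f' ** g')
| Heq_add a b (f f' g g' : hmor R a b) :
    Heq f f' -> Heq g g' -> Heq (f + g) (f' + g')
| Heq_scale a b x (f f' : hmor R a b) : Heq f f' -> Heq (x *: f) (x *: f')
| Heq_addA a b (f g h : hmor R a b) : Heq (f + (g + h)) (f + g + h)
| Heq_addC a b (f g : hmor R a b) : Heq (f + g) (g + f)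
| Heq_add0 a b (f : hmor R a b) : Heq (Hzero + f) f
| Heq_scale0 a b (f : hmor R a b) : Heq (0%R *: f) Hzero
| Heq_scale1 a b (f : hmor R a b) : Heq (1%R *: f) f
| Heq_scaleA a b x y (f : hmor R a b) : Heq (x *: (y *: f)) ((x * y)%R *: f)
| Heq_scaleDl a b x y (f : hmor R a b) :
    Heq ((x + y)%R *: f) (x *: f + y *: f)
| Heq_scaleDr a b x (f g : hmor R a b) : Heq (x *: (f + g)) (x *: f + x *: g)
| Heq_compDl a b c (f f' : hmor R b c) (g : hmor R a b) :
    Heq ((f + f') ∘ g) (f ∘ g + f' ∘ g)
| Heq_compDr a b c (f : hmor R b c) (g g' : hmor R a b) :
    Heq (f ∘ (g + g')) (f ∘ g + f ∘ g')
| Heq_compZl a b c x (f : hmor R b c) (g : hmor R a b) :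
    Heq ((x *: f) ∘ g) (x *: (f ∘ g))
| Heq_compZr a b c x (f : hmor R b c) (g : hmor R a b) :
    Heq (f ∘ (x *: g)) (x *: (f ∘ g))
| Heq_tensDl a b a' b' (f f' : hmor R a b) (g : hmor R a' b') :
    Heq ((f + f') ** g) (f ** g + f' ** g)
| Heq_tensDr a b a' b' (f : hmor R a b) (g g' : hmor R a' b') :
    Heq (f ** (g + g')) (f ** g + f ** g')
| Heq_tensZl a b a' b' x (f : hmor R a b) (g : hmor R a' b') :
    Heq ((x *: f) ** g) (x *: (f ** g))
| Heq_tensZr a b a' b' x (f : hmor R a b) (g : hmor R a' b') :
    Heq (f ** (x *: g)) (x *: (f ** g))
| Heq_idl a b (f : hmor R a b) : Heq (Hid b ∘ f) f
| Heq_idr a b (f : hmor R a b) : Heq (f ∘ Hid a) f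
| Heq_compA a b c d (f : hmor R c d) (g : hmor R b c) (h : hmor R a b) :
    Heq (f ∘ (g ∘ h)) ((f ∘ g) ∘ h)
| Heq_tens_id a b : Heq (Hid a ** Hid b) (Hid (a ++ b))
| Heq_interchange a b c a' b' c' (f : hmor R b c) (g : hmor R a b)
    (f' : hmor R b' c') (g' : hmor R a' b') :
    Heq ((f ∘ g) ** (f' ∘ g')) ((f ** f') ∘ (g ** g'))
| Heq_unitl a b (f : hmor R a b) : Heq (Hid [::] ** f) f
| Heq_unitr a b (f : hmor R a b) :
    Heq (hcast (cats0 a) (cats0 b) (f ** Hid [::])) f
| Heq_tensA a b a' b' a'' b'' (f : hmor R a b) (g : hmor R a' b')
    (h : hmor R a'' b'') :
    Heq (hcast (catA a a' a'') (catA b b' b'') (f ** (g ** h))) ((f ** g) ** h)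
(* defining relations *)
| Heq_XX : Heq (HX ∘ HX) (Hid [:: up; up])
| Heq_braid : @Heq [:: up; up; up] [:: up; up; up]
    ((HX ** 1↑) ∘ (1↑ ** HX) ∘ (HX ** 1↑))
    ((1↑ ** HX) ∘ (HX ** 1↑) ∘ (1↑ ** HX))
| Heq_zigzag_up : @Heq [:: up] [:: up] ((Hd ** 1↑) ∘ (1↑ ** Hc)) 1↑
| Heq_zigzag_down : @Heq [:: down] [:: down] ((1↓ ** Hd) ∘ (Hc ** 1↓)) 1↓
| Heq_lr : Heq (Hl ∘ Hr) (Hid [:: up; down])
| Heq_rl : Heq (Hr ∘ Hl) (Hid [:: down; up] + (-1)%R *: (Hc ∘ Hd'))
| Heq_curl : @Heq [:: up] [:: up]
    ((Hd' ** 1↑) ∘ (1↓ ** HX) ∘ (Hc ** 1↑)) Hzero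
| Heq_bubble : Heq (Hd' ∘ Hc) (Hid [::]).

Definition Heis : lincat R :=
  @LinCat R word (hmor R) Heq Hid (fun a b c f g => f ∘ g)
    (fun a b f g => f + g) (fun a b x f => x *: f).

Fixpoint ud (k : nat) : word :=
  if k is k'.+1 then [:: up, down & ud k'] else [::].

Lemma udD a b : ud a ++ ud b = ud (a + b)%N.
Proof. by elim: a => [//|a IH] /=; rewrite IH. Qed.

Definition ud_tens a b a' b' (f : hmor R (ud a) (ud b))
    (g : hmor R (ud a') (ud b')) : hmor R (ud (a + a')) (ud (b + b')) :=
  hcast (udD a a') (udD b b') (f ** g).

(* Equality in the quotient of the full monoidal subcategory on the objects  *)
(* (up down)^k: the relations are closed under operations of this            *)
(* subcategory only, not of the whole Heisenberg category.                   *)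
Inductive Hudeq (t : R) :
    forall a b, hmor R (ud a) (ud b) -> hmor R (ud a) (ud b) -> Prop :=
| Hudeq_Heq a b (f g : hmor R (ud a) (ud b)) : Heq f g -> Hudeq t f g
| Hudeq_bubble : @Hudeq t 0 0 (Hd ∘ Hc') (t *: Hid [::])
| Hudeq_sym a b (f g : hmor R (ud a) (ud b)) : Hudeq t f g -> Hudeq t g f
| Hudeq_trans a b (f g h : hmor R (ud a) (ud b)) :
    Hudeq t f g -> Hudeq t g h -> Hudeq t f h
| Hudeq_comp a b c (f f' : hmor R (ud b) (ud c)) (g g' : hmor R (ud a) (ud b)) :
    Hudeq t f f' -> Hudeq t g g' -> Hudeq t (f ∘ g) (f' ∘ g')
| Hudeq_tens a b a' b' (f f' : hmor R (ud a) (ud b))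
    (g g' : hmor R (ud a') (ud b')) :
    Hudeq t f f' -> Hudeq t g g' -> Hudeq t (ud_tens f g) (ud_tens f' g')
| Hudeq_add a b (f f' g g' : hmor R (ud a) (ud b)) :
    Hudeq t f f' -> Hudeq t g g' -> Hudeq t (f + g) (f' + g')
| Hudeq_scale a b x (f f' : hmor R (ud a) (ud b)) :
    Hudeq t f f' -> Hudeq t (x *: f) (x *: f').

(* Objects are natural numbers, k standing for (up down)^k. *)
Definition Heis_ud (t : R) : lincat R :=
  @LinCat R nat (fun a b => hmor R (ud a) (ud b)) (@Hudeq t)
    (fun a => Hid (ud a)) (fun a b c f g => f ∘ g)
    (fun a b f g => f + g) (fun a b x f => x *: f).

Definition Psi_mu : hmor R (ud 2) (ud 1) := 1↑ ** Hd' ** 1↓.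
Definition Psi_delta : hmor R (ud 1) (ud 2) := 1↑ ** Hc ** 1↓.
Definition Psi_eta : hmor R (ud 0) (ud 1) := Hc'.
Definition Psi_epsilon : hmor R (ud 1) (ud 0) := Hd.
Definition Psi_s : hmor R (ud 2) (ud 2) :=
  (1↑ ** Hr ** 1↓) ∘ (HX ** HY) ∘ (1↑ ** Hl ** 1↓)
  + 1↑ ** (Hc ∘ Hd') ** 1↓.
End Heis.

(* The strict monoidal functor k |-> (up down)^k with the given values on    *)
(* the generators.                                                           *)
Record is_Psi (R : comPzRingType) (t : R)
    (P : @linfunctor R (Par t) (Heis_ud t) (fun k => k)) : Prop := IsPsi {
  Psi_tens : forall a b a' b' (f : par_hom R a b) (g : par_hom R a' b'),
    Hudeq t (P (a + a')%N (b + b')%N (par_tens f g))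
            (ud_tens (P a b f) (P a' b' g));
  Psi_muE : Hudeq t (P 2 1 par_mu) (Psi_mu R);
  Psi_deltaE : Hudeq t (P 1 2 par_delta) (Psi_delta R);
  Psi_etaE : Hudeq t (P 0 1 par_eta) (Psi_eta R);
  Psi_epsilonE : Hudeq t (P 1 0 par_epsilon) (Psi_epsilon R);
  Psi_sE : Hudeq t (P 2 2 par_s) (Psi_s R) }.

(* Permutations are composed from right to left, (g ∘ h) x = g (h x); the    *)
(* product of perm.v is the opposite one.                                    *)
Definition pcomp n (g h : 'S_n) : 'S_n := (h * g)%g.
Notation "g ∘p h" := (pcomp g h) (at level 40, left associativity).

(* The embedding of S_m in S_n for m <= n: [extend s] is the extension of s  *)
(* to nat by the identity.  (Outside this range [emb] has no meaning.)       *)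
Definition extend m (s : 'S_m) (i : nat) : nat :=
  if insub i is Some j then val (s j) else i.

Definition emb m n (s : 'S_m) : 'S_n :=
  insubd (1%g : 'S_n) [ffun i : 'I_n => insubd i (extend s (val i))].

(* With points numbered from 0: the transposition of i and i + 1 in S_n,     *)
(* and g_i = s_i s_(i+1) ... s_(n-2), which maps n - 1 to i.                 *)
Definition adj n (i : nat) : 'S_n :=
  if n is n'.+1 then tperm (inord i) (inord i.+1) else 1%g.

Definition coset_rep n (i : 'I_n) : 'S_n :=
  foldr (@pcomp n) 1%g [seq adj n j | j <- iota i (n.-1 - i)].

Lemma extendE m (s : 'S_m) (i : 'I_m) : extend s i = s i.
Proof. by rewrite /extend valK. Qed.

Lemma extend_lt m (s : 'S_m) i : (i < m)%N -> (extend s i < m)%N.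
Proof. by move=> lt_im; rewrite (extendE s (Ordinal lt_im)). Qed.

Lemma extend_out m (s : 'S_m) i : (m <= i)%N -> extend s i = i.
Proof. by move=> le_mi; rewrite /extend insubF // ltnNge le_mi. Qed.

Lemma extendM m (s t : 'S_m) i : extend (s ∘p t) i = extend s (extend t i).
Proof.
case: (ltnP i m) => [lt_im|le_mi]; last by rewrite !extend_out.
by rewrite !(extendE _ (Ordinal lt_im)) extendE permM.
Qed.

Lemma extend1 m i : extend (1%g : 'S_m) i = i.
Proof.
case: (ltnP i m) => [lt_im|le_mi]; last by rewrite extend_out.
by rewrite (extendE _ (Ordinal lt_im)) perm1.
Qed.

Lemma extendK m (s : 'S_m) : cancel (extend s) (extend s^-1%g).
Proof. by move=> i; rewrite -extendM /pcomp mulgV extend1. Qed.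

Lemma embE m n (s : 'S_m) (i : 'I_n) :
  (m <= n)%N -> val (emb n s i) = extend s i.
Proof.
move=> le_mn; have lt_n (j : 'I_n) : (extend s j < n)%N.
  case: (ltnP j m) => [lt_jm|le_mj]; last by rewrite extend_out.
  exact: leq_trans (extend_lt s lt_jm) le_mn.
have val_f (j : 'I_n) : val (insubd j (extend s j)) = extend s j.
  by rewrite val_insubd lt_n.
rewrite /emb -pvalE insubdK ?ffunE ?val_f //.
apply/injectiveP => j k; rewrite !ffunE => /(congr1 val).
by rewrite !val_f => /(can_inj (extendK s)) /val_inj.
Qed.

Lemma embM m n (s t : 'S_m) :
  (m <= n)%N -> emb n (s ∘p t) = emb n s ∘p emb n t.
Proof.
move=> le_mn; apply/permP => i; apply: val_inj.
by rewrite permM !embE // extendM.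
Qed.

Lemma emb1 m n : (m <= n)%N -> emb n (1%g : 'S_m) = 1%g.
Proof.
move=> le_mn; apply/permP => i; apply: val_inj.
by rewrite embE // extend1 perm1.
Qed.

(* [ract g v] is v times g, for an (S_n, S_m)-bimodule. *)
Record bimod (R : comPzRingType) (n m : nat) := Bimod {
  bcar :> lmodType R;
  lact : 'S_n -> {linear bcar -> bcar};
  ract : 'S_m -> {linear bcar -> bcar};
  lact1 : forall v, lact 1%g v = v;
  ract1 : forall v, ract 1%g v = v;
  lactM : forall g h v, lact (g ∘p h) v = lact g (lact h v);
  ractM : forall g h v, ract (g ∘p h) v = ract h (ract g v);
  lract : forall g h v, lact g (ract h v) = ract h (lact g v) }.

Record bhom (R : comPzRingType) (n m : nat) (M N : bimod R n m) := BHom {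
  bfun :> {linear M -> N};
  bfun_lact : forall g v, bfun (lact M g v) = lact N g (bfun v);
  bfun_ract : forall g v, bfun (ract M g v) = ract N g (bfun v) }.

Record smod (R : comPzRingType) (n : nat) := SModule {
  scar :> lmodType R;
  sact : 'S_n -> {linear scar -> scar};
  sact1 : forall v, sact 1%g v = v;
  sactM : forall g h v, sact (g ∘p h) v = sact g (sact h v) }.

Record shom (R : comPzRingType) (n : nat) (M N : smod R n) := SHom {
  sfun :> {linear M -> N};
  sfun_act : forall g v, sfun (sact M g v) = sact N g (sfun v) }.

Section SMod.
Variables (R : comPzRingType) (n : nat).

Definition shom_id (M : smod R n) : shom M M :=
  @SHom R n M M idfun (fun _ _ => erefl).

Program Definition shom_comp (M N P : smod R n) (f : shom N P) (g : shom M N) :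
    shom M P := @SHom R n M P (f \o g) _.
Next Obligation. by move=> * /=; rewrite !sfun_act. Qed.

Program Definition shom_add (M N : smod R n) (f g : shom M N) : shom M N :=
  @SHom R n M N (f \+ g) _.
Next Obligation. by move=> * /=; rewrite !sfun_act linearD. Qed.

Program Definition shom_scale (M N : smod R n) (x : R) (f : shom M N) :
    shom M N := @SHom R n M N (x \*: f) _.
Next Obligation. by move=> * /=; rewrite !sfun_act linearZ. Qed.

Definition SMod : lincat R :=
  @LinCat R (smod R n) (@shom R n) (fun M N f g => f =1 g) shom_id shom_comp
    shom_add shom_scale.
End SMod.

(* Families (M_(n,m)) of bimodules.  A family in which, for every m, only    *)
(* finitely many M_(n,m) are nonzero is an object of the product over m of   *)
(* the direct sums over n of the categories of (S_n, S_m)-bimodules.         *)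
Definition bifam (R : comPzRingType) := forall n m : nat, bimod R n m.
Definition fhom (R : comPzRingType) (F G : bifam R) :=
  forall n m, bhom (F n m) (G n m).

Section BiFam.
Variable R : comPzRingType.

Definition bhom_id n m (M : bimod R n m) : bhom M M :=
  @BHom R n m M M idfun (fun _ _ => erefl) (fun _ _ => erefl).

Program Definition bhom_comp n m (M N P : bimod R n m) (f : bhom N P)
  (g : bhom M N) : bhom M P := @BHom R n m M P (f \o g) _ _.
Next Obligation. by move=> * /=; rewrite !bfun_lact. Qed.
Next Obligation. by move=> * /=; rewrite !bfun_ract. Qed.

Program Definition bhom_add n m (M N : bimod R n m) (f g : bhom M N) :
  bhom M N := @BHom R n m M N (f \+ g) _ _.
Next Obligation. by move=> * /=; rewrite !bfun_lact linearD. Qed.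
Next Obligation. by move=> * /=; rewrite !bfun_ract linearD. Qed.

Program Definition bhom_scale n m (M N : bimod R n m) (x : R) (f : bhom M N) :
  bhom M N := @BHom R n m M N (x \*: f) _ _.
Next Obligation. by move=> * /=; rewrite !bfun_lact linearZ. Qed.
Next Obligation. by move=> * /=; rewrite !bfun_ract linearZ. Qed.

Definition BiFam : lincat R :=
  @LinCat R (bifam R) (@fhom R) (fun F G f g => forall n m, f n m =1 g n m)
    (fun F n m => bhom_id (F n m))
    (fun F G H f g n m => bhom_comp (f n m) (g n m))
    (fun F G f g n m => bhom_add (f n m) (g n m))
    (fun F G x f n m => bhom_scale x (f n m)).
End BiFam.

(* The direct sum over k : K of the tensor products of M k and N k over the  *)
(* group algebra of S_(d k): finite sums of pure tensors, up to the          *)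
(* congruence generated by the bilinearity and balancing relations.          *)
Section Tensor.
Variables (R : comPzRingType) (K : choiceType) (d : K -> nat).
Variables (M N : K -> lmodType R).
Variable r : forall k, 'S_(d k) -> {linear M k -> M k}.
Variable l : forall k, 'S_(d k) -> {linear N k -> N k}.

Definition pure : Type := {k : K & (M k * N k)%type}.
Definition Pure k (u : M k) (v : N k) : pure := existT _ k (u, v).

Inductive teq : seq pure -> seq pure -> Prop :=
| teq_refl s : teq s s
| teq_sym s s' : teq s s' -> teq s' s
| teq_trans s s' s'' : teq s s' -> teq s' s'' -> teq s s''
| teq_cat s s' p p' : teq s s' -> teq p p' -> teq (s ++ p) (s' ++ p')
| teq_catC s s' : teq (s ++ s') (s' ++ s)
| teq_0 k (v : N k) : teq [:: Pure 0 v] [::]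
| teq_Dl k (u u' : M k) (v : N k) :
    teq [:: Pure (u + u') v] [:: Pure u v; Pure u' v]
| teq_Dr k (u : M k) (v v' : N k) :
    teq [:: Pure u (v + v')] [:: Pure u v; Pure u v']
| teq_Z k x (u : M k) (v : N k) : teq [:: Pure (x *: u) v] [:: Pure u (x *: v)]
| teq_act k g (u : M k) (v : N k) : teq [:: Pure (r g u) v] [:: Pure u (l g v)].

Definition teqb : rel (seq pure) := fun s s' => `[< teq s s' >].

Lemma teqb_equiv : equiv_class_of teqb.
Proof.
split=> [s|s s'|s s' s''].
- exact/asboolP/teq_refl.
- by apply/asboolP/asboolP => /teq_sym.
- by move=> /asboolP h /asboolP h'; apply/asboolP/(teq_trans h h').
Qed.

Canonical teqb_equivRel := EquivRelPack teqb_equiv.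

Definition tensor := {eq_quot teqb}.
HB.instance Definition _ : EqQuotient _ teqb tensor := EqQuotient.on tensor.
HB.instance Definition _ := Choice.on tensor.

Lemma tensorW (P : tensor -> Prop) :
  (forall s, P (\pi_tensor s)) -> forall a, P a.
Proof. exact: quotW. Qed.

Lemma tensor_eqP (s s' : seq pure) : \pi_tensor s = \pi_tensor s' <-> teq s s'.
Proof.
split=> [/eqmodP/asboolP //|h].
by apply/eqmodP/asboolP.
Qed.

Definition scale_pure (x : R) (p : pure) : pure :=
  Pure (x *: (tagged p).1) (tagged p).2.

Lemma teq_map_scale x s s' :
  teq s s' -> teq (map (scale_pure x) s) (map (scale_pure x) s').
Proof.
elim=> {s s'} [s|s s' _ h|s s' s'' _ h _ h'|s s' p p' _ h _ h'|s s'|k v|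
  k u u' v|k u v v'|k y u v|k g u v] /=.
- exact: teq_refl.
- exact: teq_sym h.
- exact: teq_trans h h'.
- by rewrite !map_cat; apply: teq_cat.
- by rewrite !map_cat; apply: teq_catC.
- by rewrite /scale_pure /= scaler0; apply: teq_0.
- by rewrite /scale_pure /= scalerDr; apply: teq_Dl.
- exact: teq_Dr.
- by rewrite /scale_pure /= scalerA mulrC -scalerA; apply: teq_Z.
- by rewrite /scale_pure /= -linearZ; apply: teq_act.
Qed.

Lemma teq_eta (p : pure) : p = Pure (tagged p).1 (tagged p).2.
Proof. by case: p => k []. Qed.

Lemma teq_catCA s1 s2 s3 s4 :
  teq ((s1 ++ s2) ++ (s3 ++ s4)) ((s1 ++ s3) ++ (s2 ++ s4)).
Proof.
rewrite -!catA; apply: teq_cat (teq_refl _) _; rewrite !catA.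
exact: teq_cat (teq_catC _ _) (teq_refl _).
Qed.

Lemma teq_map_scale0 s : teq (map (scale_pure 0) s) [::].
Proof.
elim: s => [|p s IH] /=; first exact: teq_refl.
rewrite -[[::]]/([::] ++ [::]) -cat1s; apply: teq_cat IH.
by rewrite /scale_pure scale0r; apply: teq_0.
Qed.

Lemma teq_map_scaleDl x y s : teq (map (scale_pure (x + y)) s)
  (map (scale_pure x) s ++ map (scale_pure y) s).
Proof.
elim: s => [|p s IH] /=; first exact: teq_refl.
apply: teq_trans (teq_catCA [:: _] [:: _] _ _).
rewrite -cat1s {1}/scale_pure scalerDl.
exact: teq_cat (teq_Dl _ _ _) IH.
Qed.

Definition tens0 : tensor := \pi_tensor [::].
Definition tens_add (a b : tensor) : tensor :=
  \pi_tensor (generic_quotient.repr a ++ generic_quotient.repr b).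
Definition tens_scale (x : R) (a : tensor) : tensor :=
  \pi_tensor (map (scale_pure x) (generic_quotient.repr a)).
Definition tens_opp (a : tensor) : tensor := tens_scale (-1) a.

Lemma tens_addE s s' :
  tens_add (\pi_tensor s) (\pi_tensor s') = \pi_tensor (s ++ s').
Proof. by apply/tensor_eqP/teq_cat; apply/tensor_eqP; rewrite reprK. Qed.

Lemma tens_scaleE x s :
  tens_scale x (\pi_tensor s) = \pi_tensor (map (scale_pure x) s).
Proof. by apply/tensor_eqP/teq_map_scale/tensor_eqP; rewrite reprK. Qed.

Lemma tens_addA : associative tens_add.
Proof.
move=> a b c; elim/tensorW: a => a; elim/tensorW: b => b; elim/tensorW: c => c.
by rewrite !tens_addE catA.
Qed.

Lemma tens_addC : commutative tens_add.
Proof.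
move=> a b; elim/tensorW: a => a; elim/tensorW: b => b; rewrite !tens_addE.
exact/tensor_eqP/teq_catC.
Qed.

Lemma tens_add0 : left_id tens0 tens_add.
Proof. by move=> a; elim/tensorW: a => a; rewrite tens_addE. Qed.

Lemma tens_scale1 : left_id 1 tens_scale.
Proof.
move=> a; elim/tensorW: a => a; rewrite tens_scaleE; congr (\pi_tensor _).
rewrite -[RHS]map_id.
by apply: eq_map => p; rewrite /scale_pure scale1r -teq_eta.
Qed.

Lemma tens_scale0 a : tens_scale 0 a = tens0.
Proof.
by elim/tensorW: a => a; rewrite tens_scaleE; apply/tensor_eqP/teq_map_scale0.
Qed.

Lemma tens_scaleDl a : {morph tens_scale^~ a : x y / x + y >-> tens_add x y}.
Proof.
move=> x y /=; elim/tensorW: a => a; rewrite !tens_scaleE tens_addE.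
exact/tensor_eqP/teq_map_scaleDl.
Qed.

Lemma tens_scaleDr : right_distributive tens_scale tens_add.
Proof.
move=> x a b; elim/tensorW: a => a; elim/tensorW: b => b.
by rewrite !(tens_scaleE, tens_addE) map_cat.
Qed.

Lemma tens_scaleA x y a : tens_scale x (tens_scale y a) = tens_scale (x * y) a.
Proof.
elim/tensorW: a => a; rewrite !tens_scaleE -map_comp; congr (\pi_tensor _).
by apply: eq_map => p; rewrite /scale_pure /= scalerA.
Qed.

Lemma tens_addN : left_inverse tens0 tens_opp tens_add.
Proof.
move=> a; rewrite /tens_opp -{2}[a]tens_scale1 -tens_scaleDl addNr.
exact: tens_scale0.
Qed.

HB.instance Definition _ := GRing.isZmodule.Build tensor
  tens_addA tens_addC tens_add0 tens_addN.
HB.instance Definition _ := GRing.Zmodule_isLmodule.Build R tensor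
  tens_scaleA tens_scale1 tens_scaleDr tens_scaleDl.

Definition tpure k (u : M k) (v : N k) : tensor := \pi_tensor [:: Pure u v].

End Tensor.

Arguments tpure {R K d M N} r l k u v.

Section TensorMap.
Variables (R : comPzRingType) (K : choiceType) (d : K -> nat).
Variables (M N M' N' : K -> lmodType R).
Variable r : forall k, 'S_(d k) -> {linear M k -> M k}.
Variable l : forall k, 'S_(d k) -> {linear N k -> N k}.
Variable r' : forall k, 'S_(d k) -> {linear M' k -> M' k}.
Variable l' : forall k, 'S_(d k) -> {linear N' k -> N' k}.
Variables (f : forall k, {linear M k -> M' k}).
Variables (g : forall k, {linear N k -> N' k}).
Hypothesis fr : forall k s u, f k (r s u) = r' s (f k u).
Hypothesis gl : forall k s v, g k (l s v) = l' s (g k v).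

Definition pure_map (p : pure M N) : pure M' N' :=
  Pure (f (tag p) (tagged p).1) (g (tag p) (tagged p).2).

Lemma teq_map s s' :
  teq r l s s' -> teq r' l' (map pure_map s) (map pure_map s').
Proof using fr gl.
elim=> {s s'} [s|s s' _ h|s s' s'' _ h _ h'|s s' p p' _ h _ h'|s s'|k v|
  k u u' v|k u v v'|k y u v|k h u v] /=.
- exact: teq_refl.
- exact: teq_sym h.
- exact: teq_trans h h'.
- by rewrite !map_cat; apply: teq_cat.
- by rewrite !map_cat; apply: teq_catC.
- by rewrite /pure_map /= linear0; apply: teq_0.
- by rewrite /pure_map /= linearD; apply: teq_Dl.
- by rewrite /pure_map /= linearD; apply: teq_Dr.
- by rewrite /pure_map /= !linearZ; apply: teq_Z.
- by rewrite /pure_map /= fr gl; apply: teq_act.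
Qed.

Definition tensor_fun (a : tensor r l) : tensor r' l' :=
  \pi_(tensor r' l') (map pure_map (generic_quotient.repr a)).

Lemma tensor_funE s :
  tensor_fun (\pi_(tensor r l) s) = \pi_(tensor r' l') (map pure_map s).
Proof using fr gl.
by apply/tensor_eqP/teq_map/tensor_eqP; rewrite reprK.
Qed.

Lemma tensor_fun_linear : linear tensor_fun.
Proof using fr gl.
move=> x a b; elim/tensorW: a => a; elim/tensorW: b => b.
rewrite [_ *: _]tens_scaleE [_ + _]tens_addE !tensor_funE.
rewrite [_ *: _]tens_scaleE [_ + _]tens_addE map_cat -!map_comp.
congr (\pi_(tensor r' l') (_ ++ _)); apply: eq_map => p.
by rewrite /pure_map /scale_pure /= linearZ.
Qed.

Definition tensor_map : {linear tensor r l -> tensor r' l'} :=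
  HB.pack tensor_fun (GRing.isLinear.Build _ _ _ _ _ tensor_fun_linear).

Lemma tensor_mapE k (u : M k) (v : N k) :
  tensor_map (tpure r l k u v) = tpure r' l' k (f k u) (g k v).
Proof using. exact: tensor_funE. Qed.
End TensorMap.

Arguments tensor_map {R K d M N M' N'} r l r' l' f g fr gl.

Section TensorMapTheory.
Variables (R : comPzRingType) (K : choiceType) (d : K -> nat).

Lemma tensor_ind (M N : K -> lmodType R)
    (r : forall k, 'S_(d k) -> {linear M k -> M k})
    (l : forall k, 'S_(d k) -> {linear N k -> N k})
    (P : tensor r l -> Prop) :
  P 0 -> (forall k u v, P (tpure r l k u v)) ->
  (forall a b, P a -> P b -> P (a + b)) -> forall a, P a.
Proof.
move=> P0 P1 PD a; elim/tensorW: a; elim=> [|[k [u v]] s IH] //.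
rewrite -cat1s; have := PD _ _ (P1 k u v) IH.
by rewrite [X in P X]tens_addE.
Qed.

Lemma tensor_ext (M N : K -> lmodType R)
    (r : forall k, 'S_(d k) -> {linear M k -> M k})
    (l : forall k, 'S_(d k) -> {linear N k -> N k})
    (P : lmodType R) (f g : {linear tensor r l -> P}) :
  (forall k u v, f (tpure r l k u v) = g (tpure r l k u v)) -> f =1 g.
Proof.
move=> fg; elim/tensor_ind => [|//|a b fa fb]; first by rewrite !linear0.
by rewrite !linearD fa fb.
Qed.
End TensorMapTheory.

Section FTens.
Variables (R : comPzRingType) (F G : bifam R) (n m : nat).

Let r (k : nat) (s : 'S_k) := ract (F n k) s.
Let l (k : nat) (s : 'S_k) := lact (G k m) s.

Definition ftens_space : lmodType R := @tensor R nat id (F n) (G^~ m) r l.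

Definition fpure k (u : F n k) (v : G k m) : ftens_space :=
  tpure r l k u v.

Definition ftens_lact (g : 'S_n) : {linear ftens_space -> ftens_space} :=
  tensor_map r l r l (fun k => lact (F n k) g) (fun k => idfun)
    (fun k s u => lract g s u) (fun k s v => erefl).

Definition ftens_ract (g : 'S_m) : {linear ftens_space -> ftens_space} :=
  tensor_map r l r l (fun k => idfun) (fun k => ract (G k m) g)
    (fun k s u => erefl) (fun k s v => esym (lract s g v)).

Lemma ftens_lactE g k u v : ftens_lact g (@fpure k u v) = fpure (lact _ g u) v.
Proof. exact: tensor_mapE. Qed.

Lemma ftens_ractE g k u v : ftens_ract g (@fpure k u v) = fpure u (ract _ g v).
Proof. exact: tensor_mapE. Qed.

Lemma ftens_lact1 v : ftens_lact 1%g v = v.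
Proof.
elim/tensor_ind: v => [|k u v|a b ha hb]; first by rewrite linear0.
  by rewrite ftens_lactE lact1.
by rewrite linearD ha hb.
Qed.

Lemma ftens_ract1 v : ftens_ract 1%g v = v.
Proof.
elim/tensor_ind: v => [|k u v|a b ha hb]; first by rewrite linear0.
  by rewrite ftens_ractE ract1.
by rewrite linearD ha hb.
Qed.

Lemma ftens_lactM g h v :
  ftens_lact (g ∘p h) v = ftens_lact g (ftens_lact h v).
Proof.
elim/tensor_ind: v => [|k u v|a b ha hb]; first by rewrite !linear0.
  by rewrite !ftens_lactE lactM.
by rewrite !linearD ha hb.
Qed.

Lemma ftens_ractM g h v :
  ftens_ract (g ∘p h) v = ftens_ract h (ftens_ract g v).
Proof.
elim/tensor_ind: v => [|k u v|a b ha hb]; first by rewrite !linear0.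
  by rewrite !ftens_ractE ractM.
by rewrite !linearD ha hb.
Qed.

Lemma ftens_lract g h v :
  ftens_lact g (ftens_ract h v) = ftens_ract h (ftens_lact g v).
Proof.
elim/tensor_ind: v => [|k u v|a b ha hb]; first by rewrite !linear0.
  by rewrite ftens_ractE !ftens_lactE ftens_ractE.
by rewrite !linearD ha hb.
Qed.

Definition ftens_bimod : bimod R n m :=
  Bimod ftens_lact1 ftens_ract1 ftens_lactM ftens_ractM ftens_lract.
End FTens.

Definition ftens (R : comPzRingType) (F G : bifam R) : bifam R :=
  fun n m => ftens_bimod F G n m.

Section FTensMap.
Variables (R : comPzRingType) (F F' G G' : bifam R).
Variables (f : fhom F F') (g : fhom G G').

Definition ftens_fun n m : {linear ftens F G n m -> ftens F' G' n m} :=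
  @tensor_map R nat id (F n) (G^~ m) (F' n) (G'^~ m)
    (fun k s => ract (F n k) s) (fun k s => lact (G k m) s)
    (fun k s => ract (F' n k) s) (fun k s => lact (G' k m) s)
    (fun k => f n k) (fun k => g k m)
    (fun k s u => bfun_ract (f n k) s u) (fun k s v => bfun_lact (g k m) s v).

Lemma ftens_funE n m k (u : F n k) (v : G k m) :
  ftens_fun n m (fpure u v) = fpure (f n k u) (g k m v).
Proof. exact: tensor_mapE. Qed.

Lemma ftens_fun_lact n m s v :
  ftens_fun n m (lact _ s v) = lact _ s (ftens_fun n m v).
Proof.
elim/tensor_ind: v => [|k u v|a b ha hb]; first by rewrite !linear0.
  rewrite [lact _ _ _]ftens_lactE !ftens_funE [RHS]ftens_lactE.
  by rewrite bfun_lact.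
by rewrite !linearD ha hb.
Qed.

Lemma ftens_fun_ract n m s v :
  ftens_fun n m (ract _ s v) = ract _ s (ftens_fun n m v).
Proof.
elim/tensor_ind: v => [|k u v|a b ha hb]; first by rewrite !linear0.
  rewrite [ract _ _ _]ftens_ractE !ftens_funE [RHS]ftens_ractE.
  by rewrite bfun_ract.
by rewrite !linearD ha hb.
Qed.

Definition ftens_map : fhom (ftens F G) (ftens F' G') :=
  fun n m => BHom (@ftens_fun_lact n m) (@ftens_fun_ract n m).
End FTensMap.

(* The S_n-module M (x)_m W, for an (S_n, S_m)-bimodule M and an S_m-module  *)
(* W: a tensor product with a single summand.                                *)
Section STens.
Variables (R : comPzRingType) (n m : nat) (M : bimod R n m) (W : smod R m).

Let r (k : unit) (s : 'S_m) := ract M s.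
Let l (k : unit) (s : 'S_m) := sact W s.

Definition stens_space : lmodType R :=
  @tensor R unit (fun=> m) (fun=> M) (fun=> W) r l.

Definition spure (u : M) (v : W) : stens_space := tpure r l tt u v.

Definition stens_act (g : 'S_n) : {linear stens_space -> stens_space} :=
  tensor_map r l r l (fun k => lact M g) (fun k => idfun)
    (fun k s u => lract g s u) (fun k s v => erefl).

Lemma stens_actE g u v : stens_act g (spure u v) = spure (lact _ g u) v.
Proof. exact: tensor_mapE. Qed.

Lemma stens_act1 v : stens_act 1%g v = v.
Proof.
elim/tensor_ind: v => [|[] u v|a b ha hb]; first by rewrite linear0.
  by rewrite stens_actE lact1.
by rewrite linearD ha hb.
Qed.

Lemma stens_actM g h v : stens_act (g ∘p h) v = stens_act g (stens_act h v).
Proof.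
elim/tensor_ind: v => [|[] u v|a b ha hb]; first by rewrite !linear0.
  by rewrite !stens_actE lactM.
by rewrite !linearD ha hb.
Qed.

Definition stens : smod R n := SModule stens_act1 stens_actM.
End STens.

Section STensMap.
Variables (R : comPzRingType) (n m : nat) (M N : bimod R n m) (W : smod R m).
Variable f : bhom M N.

Definition stens_fun : {linear stens M W -> stens N W} :=
  @tensor_map R unit (fun=> m) (fun=> M) (fun=> W) (fun=> N) (fun=> W)
    (fun k s => ract M s) (fun k s => sact W s)
    (fun k s => ract N s) (fun k s => sact W s)
    (fun k => f) (fun k => idfun)
    (fun k s u => bfun_ract f s u) (fun k s v => erefl).

Lemma stens_funE u v : stens_fun (spure u v) = spure (f u) v.
Proof. exact: tensor_mapE. Qed.

Lemma stens_fun_act s v : stens_fun (sact _ s v) = sact _ s (stens_fun v).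
Proof.
elim/tensor_ind: v => [|[] u v|a b ha hb]; first by rewrite !linear0.
  by rewrite [sact _ _ _]stens_actE !stens_funE [RHS]stens_actE bfun_lact.
by rewrite !linearD ha hb.
Qed.

Definition stens_map : shom (stens M W) (stens N W) := SHom stens_fun_act.
End STensMap.

(* The (S_n, S_m)-bimodule of the group algebra of S_N if [b] holds, and the *)
(* zero bimodule otherwise: functions on the elements of S_N subject to [b]. *)
Section PermBimod.
Variables (R : comPzRingType) (N n m : nat) (b : bool).
Hypothesis le_N : b -> (n <= N)%N && (m <= N)%N.

Definition perms : finType := {g : 'S_N | b}.
Definition perm_mod : lmodType R := {ffun perms -> R^o}.

(* The basis vector g (or 0 if b is false). *)
Definition pvec (g : 'S_N) : perm_mod := [ffun x => (val x == g)%:R].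

Definition perm_lact_fun (g : 'S_n) (v : perm_mod) : perm_mod :=
  [ffun x : perms => v (Sub (emb N g^-1%g ∘p val x) (valP x))].
Definition perm_ract_fun (g : 'S_m) (v : perm_mod) : perm_mod :=
  [ffun x : perms => v (Sub (val x ∘p emb N g^-1%g) (valP x))].

Lemma perm_lact_linear g : linear (perm_lact_fun g).
Proof. by move=> a u v; apply/ffunP => x; rewrite !ffunE. Qed.

Lemma perm_ract_linear g : linear (perm_ract_fun g).
Proof. by move=> a u v; apply/ffunP => x; rewrite !ffunE. Qed.

Definition perm_lact g : {linear perm_mod -> perm_mod} :=
  HB.pack (perm_lact_fun g)
    (GRing.isLinear.Build _ _ _ _ _ (perm_lact_linear g)).
Definition perm_ract g : {linear perm_mod -> perm_mod} :=
  HB.pack (perm_ract_fun g)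
    (GRing.isLinear.Build _ _ _ _ _ (perm_ract_linear g)).

Lemma pcompA k (g h i : 'S_k) : g ∘p (h ∘p i) = (g ∘p h) ∘p i.
Proof. by rewrite /pcomp mulgA. Qed.

Lemma pcompV k (g h : 'S_k) : (g ∘p h)^-1%g = h^-1%g ∘p g^-1%g.
Proof. exact: invMg. Qed.

Lemma perm_lact1 v : perm_lact 1%g v = v.
Proof using le_N.
apply/ffunP => x; rewrite ffunE; congr (v _); apply: val_inj => /=.
by have /andP[? _] := le_N (valP x); rewrite invg1 emb1 // /pcomp mulg1.
Qed.

Lemma perm_ract1 v : perm_ract 1%g v = v.
Proof using le_N.
apply/ffunP => x; rewrite ffunE; congr (v _); apply: val_inj => /=.
by have /andP[_ ?] := le_N (valP x); rewrite invg1 emb1 // /pcomp mul1g.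
Qed.

Lemma perm_lactM g h v :
  perm_lact (g ∘p h) v = perm_lact g (perm_lact h v).
Proof using le_N.
apply/ffunP => x; rewrite !ffunE; congr (v _); apply: val_inj => /=.
by have /andP[? _] := le_N (valP x); rewrite pcompV embM // pcompA.
Qed.

Lemma perm_ractM g h v :
  perm_ract (g ∘p h) v = perm_ract h (perm_ract g v).
Proof using le_N.
apply/ffunP => x; rewrite !ffunE; congr (v _); apply: val_inj => /=.
by have /andP[_ ?] := le_N (valP x); rewrite pcompV embM // pcompA.
Qed.

Lemma perm_lract g h v :
  perm_lact g (perm_ract h v) = perm_ract h (perm_lact g v).
Proof.
apply/ffunP => x; rewrite !ffunE; congr (v _); apply: val_inj => /=.
by rewrite pcompA.
Qed.

Definition perm_bimod : bimod R n m :=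
  Bimod perm_lact1 perm_ract1 perm_lactM perm_ractM perm_lract.
End PermBimod.

Lemma le_Id n m : n == m -> (n <= n)%N && (m <= n)%N.
Proof. by move/eqP->; rewrite leqnn. Qed.
Lemma le_Up n m : n == m.+1 -> (n <= n)%N && (m <= n)%N.
Proof. by move/eqP->; rewrite leqnn leqnSn. Qed.
Lemma le_Down n m : m == n.+1 -> (n <= m)%N && (m <= m)%N.
Proof. by move/eqP->; rewrite leqnn leqnSn. Qed.

Section ThetaOb.
Variable R : comPzRingType.

(* The families (n), n >= 0, (n)_(n-1) and _(n-1)(n), n >= 1. *)
Definition fam_Id : bifam R := fun n m => perm_bimod R (@le_Id n m).
Definition fam_Up : bifam R := fun n m => perm_bimod R (@le_Up n m).
Definition fam_Down : bifam R := fun n m => perm_bimod R (@le_Down n m).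

Definition vId n m (g : 'S_n) : fam_Id n m := pvec R (n == m) g.
Definition vUp n m (g : 'S_n) : fam_Up n m := pvec R (n == m.+1) g.
Definition vDown n m (g : 'S_m) : fam_Down n m := pvec R (m == n.+1) g.

Definition Theta_arrow (x : arrow) : bifam R :=
  if x is up then fam_Up else fam_Down.

Fixpoint Theta_ob (w : word) : bifam R :=
  match w with
  | [::] => fam_Id
  | x :: w' => match w' with
               | [::] => Theta_arrow x
               | _ :: _ => ftens (Theta_arrow x) (Theta_ob w')
               end
  end.
End ThetaOb.

Arguments vId {R n} m g.
Arguments vUp {R n} m g.
Arguments vDown {R} n {m} g.

(* Theta is the strong monoidal functor given on objects by [Theta_ob], with *)
(* the canonical structure isomorphisms [phi] (given by the bimodule         *)
(* structure if one of the factors is the unit object, and by reassociation  *)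
(* otherwise), and by the usual formulas on the generating morphisms.  In    *)
(* these, _(n-1)(n)_(n-1) and (n)_(n-2) are seen as the tensor products      *)
(* _(n-1)(n) (x)_n (n)_(n-1) and (n)_(n-1) (x)_(n-1) (n-1)_(n-2), via the    *)
(* isomorphisms g (x) h |-> gh; components are indexed by the smallest       *)
(* number for which the bimodules are defined.                               *)
Record is_Theta (R : comPzRingType)
    (T : @linfunctor R (Heis R) (BiFam R) (@Theta_ob R))
    (phi : forall a b, fhom (ftens (@Theta_ob R a) (@Theta_ob R b))
                            (@Theta_ob R (a ++ b))) : Prop := IsTheta {
  phi_iso : forall a b,
    @is_iso R (BiFam R) (ftens (@Theta_ob R a) (@Theta_ob R b))
      (@Theta_ob R (a ++ b)) (phi a b);
  phi_unitl : forall b n m (g : 'S_n) (v : @Theta_ob R b n m),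
    phi [::] b n m (@fpure R (@fam_Id R) (@Theta_ob R b) n m n (vId n g) v) =
    lact _ g v;
  phi_unitr : forall x n m (u : @Theta_arrow R x n m) (g : 'S_m),
    phi [:: x] [::] n m
      (@fpure R (@Theta_arrow R x) (@fam_Id R) n m m u (vId m g)) =
    ract _ g u;
  phi_cons1 : forall x y b n m k (u : @Theta_arrow R x n k)
      (v : @Theta_ob R (y :: b) k m),
    phi [:: x] (y :: b) n m (fpure u v) = fpure u v;
  phi_cons : forall x y a b n m k l (u : @Theta_arrow R x n k)
      (v : @Theta_ob R (y :: a) k l) (w : @Theta_ob R b l m),
    phi [:: x, y & a] b n m
      (@fpure R (@Theta_ob R [:: x, y & a]) (@Theta_ob R b) n m l
        (fpure u v) w) =
    @fpure R (@Theta_arrow R x) (@Theta_ob R ((y :: a) ++ b)) n m k u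
      (phi (y :: a) b k m (fpure v w));
  Theta_tens : forall a b a' b' (f : hmor R a b) (f' : hmor R a' b') n m v,
    T _ _ (Htens f f') n m (phi a a' n m v) =
    phi b b' n m (ftens_map (T _ _ f) (T _ _ f') n m v);
  Theta_X : forall n (g : 'S_n.+2) (h : 'S_n.+1),
    T _ _ HX n.+2 n
      (@fpure R (@fam_Up R) (@fam_Up R) n.+2 n n.+1 (vUp n.+1 g) (vUp n h)) =
    fpure (vUp n.+1 (g ∘p emb n.+2 h ∘p adj n.+2 n)) (vUp n 1%g);
  Theta_c : forall n (g : 'S_n),
    T _ _ Hc n n (vId n g) =
    @fpure R (@fam_Down R) (@fam_Up R) n n n.+1
      (vDown n 1%g) (vUp n (emb n.+1 g));
  Theta_d : forall n (g h : 'S_n.+1),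
    T _ _ Hd n.+1 n.+1
      (@fpure R (@fam_Up R) (@fam_Down R) n.+1 n.+1 n (vUp n g) (vDown n h)) =
    vId n.+1 (g ∘p h);
  Theta_c' : forall n (g : 'S_n.+1),
    T _ _ Hc' n.+1 n.+1 (vId n.+1 g) =
    \sum_(i < n.+1) @fpure R (@fam_Up R) (@fam_Down R) n.+1 n.+1 n
      (vUp n (coset_rep i)) (vDown n ((coset_rep i)^-1%g ∘p g));
  Theta_d'_in : forall n (g h : 'S_n.+1) (x : 'S_n), g ∘p h = emb n.+1 x ->
    T _ _ Hd' n n (@fpure R (@fam_Down R) (@fam_Up R) n n n.+1
      (vDown n g) (vUp n h)) = vId n x;
  Theta_d'_out : forall n (g h : 'S_n.+1),
    (forall x : 'S_n, g ∘p h <> emb n.+1 x) ->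
    T _ _ Hd' n n (@fpure R (@fam_Down R) (@fam_Up R) n n n.+1
      (vDown n g) (vUp n h)) = 0 }.

Definition triv (R : comPzRingType) (n : nat) : smod R n :=
  @SModule R n (R^o : lmodType R) (fun=> idfun) (fun=> erefl)
    (fun _ _ _ => erefl).

Definition Omega_ob (R : comPzRingType) (n k : nat) : smod R n :=
  stens (@Theta_ob R (ud k) n n) (triv R n).

(* The functor induced by f |-> Theta(f)_(n,n) (x)_n 1_n. *)
Definition is_Omega (R : comPzRingType) (n : nat)
    (T : @linfunctor R (Heis R) (BiFam R) (@Theta_ob R))
    (O : @linfunctor R (Heis_ud n%:R) (SMod R n) (@Omega_ob R n)) : Prop :=
  forall a b (f : hmor R (ud a) (ud b)) v,
    O a b f v = stens_map (triv R n) (T (ud a) (ud b) f n n) v.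

Section Phi.
Variables (R : comPzRingType) (n : nat).

(* The k-th tensor power of V = R^n, as the free module on k-tuples of       *)
(* elements of {0, ..., n-1}, listed from left to right.                     *)
Definition vpow_mod (k : nat) : lmodType R :=
  {ffun {ffun 'I_k -> 'I_n} -> R^o}.

Definition vpow_act_fun k (g : 'S_n) (v : vpow_mod k) : vpow_mod k :=
  [ffun i : {ffun 'I_k -> 'I_n} => v [ffun p => g^-1%g (i p)]].

Lemma vpow_act_linear k g : linear (@vpow_act_fun k g).
Proof. by move=> a u v; apply/ffunP => x; rewrite !ffunE. Qed.

Definition vpow_act k g : {linear vpow_mod k -> vpow_mod k} :=
  HB.pack (@vpow_act_fun k g)
    (GRing.isLinear.Build _ _ _ _ _ (@vpow_act_linear k g)).

Lemma vpow_act1 k v : @vpow_act k 1%g v = v.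
Proof.
apply/ffunP => i; rewrite ffunE; congr (v _); apply/ffunP => p.
by rewrite ffunE invg1 perm1.
Qed.

Lemma vpow_actM k g h v :
  @vpow_act k (g ∘p h) v = vpow_act k g (vpow_act k h v).
Proof.
apply/ffunP => i; rewrite !ffunE; congr (v _); apply/ffunP => p.
by rewrite !ffunE pcompV permM.
Qed.

Definition Vpow (k : nat) : smod R n := SModule (@vpow_act1 k) (@vpow_actM k).

Definition tbasis k (i : {ffun 'I_k -> 'I_n}) : Vpow k :=
  [ffun j : {ffun 'I_k -> 'I_n} => (j == i)%:R] : vpow_mod k.

Definition vtens a b (u : Vpow a) (v : Vpow b) : Vpow (a + b)%N :=
  [ffun i : {ffun 'I_(a + b) -> 'I_n} =>
     (u : vpow_mod a) [ffun p => i (lshift b p)] *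
     (v : vpow_mod b) [ffun p => i (rshift a p)]] : vpow_mod (a + b).

(* The strong monoidal functor k |-> Vpow k, with the canonical structure    *)
(* isomorphisms u (x) v |-> vtens u v.                                       *)
Record is_Phi (F : @linfunctor R (Par n%:R) (SMod R n) Vpow) : Prop := IsPhi {
  Phi_tens : forall a b a' b' (f : par_hom R a b) (f' : par_hom R a' b') u v,
    F (a + a')%N (b + b')%N (par_tens f f') (vtens u v) =
    vtens (F a b f u) (F a' b' f' v);
  Phi_mu : forall i : {ffun 'I_2 -> 'I_n}, F 2 1 par_mu (tbasis i) =
    if i ord0 == i ord_max then tbasis [ffun=> i ord0] else 0;
  Phi_eta : forall i : {ffun 'I_0 -> 'I_n}, F 0 1 par_eta (tbasis i) =
    \sum_(j < n) tbasis [ffun=> j];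
  Phi_delta : forall i : {ffun 'I_1 -> 'I_n}, F 1 2 par_delta (tbasis i) =
    tbasis [ffun=> i ord0];
  Phi_epsilon : forall i : {ffun 'I_1 -> 'I_n},
    F 1 0 par_epsilon (tbasis i) = tbasis [ffun p : 'I_0 => i ord0];
  Phi_s : forall i : {ffun 'I_2 -> 'I_n}, F 2 2 par_s (tbasis i) =
    tbasis [ffun p => i (rev_ord p)] }.
End Phi.

Section Beta.
Variables (R : comPzRingType) (n : nat).

(* With B = (n)_(n-1), the module Omega_n((up down)^k) is obtained from      *)
(* B^k (x)_(n-1) 1_(n-1) by inserting, after each factor B, one factor       *)
(* _(n-1)(n), using B = _(n-1)(n) (x)_n B, x = 1 (x) x, and likewise         *)
(* 1_(n-1) = _(n-1)(n) (x)_n 1_n.  Hence x_1 (x) ... (x) x_k (x) 1 is        *)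
(* identified with x_1 (x) 1 (x) x_2 (x) 1 (x) ... (x) x_k (x) 1 (x) 1.      *)
(* [ud_cons] puts g (x) 1 in front of such a tensor.                         *)
Definition ud_cons k (g : 'S_n) :
    @Theta_ob R (ud k) n n -> @Theta_ob R (ud k.+1) n n :=
  match k return @Theta_ob R (ud k) n n -> @Theta_ob R (ud k.+1) n n with
  | 0 => fun _ =>
      @fpure R (@fam_Up R) (@fam_Down R) n n n.-1 (vUp n.-1 g) (vDown n.-1 1%g)
  | k'.+1 => fun t =>
      @fpure R (@fam_Up R) (@Theta_ob R (down :: ud k'.+1)) n n n.-1
        (vUp n.-1 g)
        (@fpure R (@fam_Down R) (@Theta_ob R (ud k'.+1)) n.-1 n n
          (vDown n.-1 1%g) t)
  end.

(* h^-1 g_(i_0) (x) g_(i_0)^-1 g_(i_1) (x) ..., identified as above. *)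
Fixpoint beta_vec k (h : 'S_n) :
    {ffun 'I_k -> 'I_n} -> @Theta_ob R (ud k) n n :=
  match k with
  | 0 => fun _ => vId n 1%g
  | k'.+1 => fun i =>
      let g := coset_rep (i ord0) in
      ud_cons (h^-1%g ∘p g) (beta_vec g [ffun p : 'I_k' => i (lift ord0 p)])
  end.

Definition beta_val k (i : {ffun 'I_k -> 'I_n}) : Omega_ob R n k :=
  @spure R n n (@Theta_ob R (ud k) n n) (triv R n)
    (beta_vec 1%g i) (1 : R^o).
End Beta.

(* Main.v *)
(* Let w_i = g_(i_1) (x) g_(i_1)^-1 g_(i_2) (x) ... (x) g_(i_k)^-1 in the    *)
(* (S_n, S_n)-bimodule Theta((up down)^k).  Since the product of its factors *)
(* is 1, g w_i = w_(g i) g, so w_i (x) 1 is the image of v_i under beta_k,   *)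
(* and w_(ij) is the tensor product of w_i and w_j.  Call a morphism f of    *)
(* the partition category intertwined if Theta(Psi f) w_i = w_(Phi(f) v_i),  *)
(* already in bimodules.  This property, unlike naturality of beta, is       *)
(* obviously stable under tensor products; as the diagrams are generated by  *)
(* mu, delta, eta, epsilon and s, it is enough to check it for these.        *)

From HB Require Import structures.
Require Import Defs.
From mathcomp Require Import all_boot all_order all_algebra all_fingroup.
From mathcomp Require Import boolp.
(* fingroup and ssrfun also define [ract] and [pcomp]. *)
Import Defs.

Set Implicit Arguments.
Unset Strict Implicit.
Unset Printing Implicit Defensive.

Import GRing.Theory.
Local Open Scope ring_scope.

(** * Generation of the partition category *)

(** Naturality of beta cannot be checked generator by generator after applying [Omega], which is not
    monoidal. The comparison is therefore lifted to the bimodules, where [Theta] is monoidal, by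
    means of the vectors w_i ([wvec]). They are multiplicative in the index tuple ([wvec_cat]), and
    a permutation passes through them from left to right while permuting the indices ([lact_wvec]).
    Tensoring with the trivial module erases factors on the right. This yields the prescribed
    formula for beta ([beta_vecE]), its equivariance ([beta_map_act]), and naturality as soon as
    Theta(Psi f) acts on the w_i as Phi(f) acts on the v_i ([intertwined_all]).

    Intertwining is stable under linear combinations, composition and tensor products, so two things
    remain. One is that all diagrams are generated by the five elementary ones
    ([diagram_generated]). The stackings used there create no closed component, since a closed
    component would bring in a factor n, which may fail to be invertible. The other is the value of
    Theta(Psi f) for the generators. For mu, delta, eta and epsilon it is read off the formulas. For
    s, the group S_(n+1) is the union of the double cosets S_n and S_n s_n S_n: l kills the first
    one and r embeds into the second ([T_l_1], [T_l_double_coset], [T_r]). The two summands of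
    Psi(s) thus handle i <> j and i = j respectively; equivariance leaves one computation for each
    ([T_Psi_s_max], [T_Psi_s_diag_max]).

    Finally, beta is bijective because the w_i generate the bimodule from the right ([wvec_span])
    and admit dual functionals that are invariant under the right action ([wvec_coef]). *)

Section SameBlock.
Variables (m l : nat) (D : diagram m l).

Lemma mem_cover_diagram x : x \in cover (val D).
Proof. by have /and3P[/eqP-> _ _] := valP D; rewrite inE. Qed.

Lemma same_block_refl x : same_block D x x.
Proof. by rewrite /same_block mem_pblock mem_cover_diagram. Qed.

Lemma same_block_trans x y :
  same_block D x y -> same_block D x =1 same_block D y.
Proof.
have /and3P[_ tri _] := valP D.
by rewrite /same_block => /(same_pblock tri) ->.
Qed.

Lemma same_block_sym : symmetric (same_block D).
Proof.
by move=> x y; apply/idP/idP => /same_block_trans <-; apply: same_block_refl.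
Qed.
End SameBlock.

Lemma symclos_connect_sym (T : finType) (e : rel T) : connect_sym (symclos e).
Proof. by apply: sym_connect_sym => x y; rewrite /symclos orbC. Qed.

Lemma same_block_diagram_of m l (e : rel (vertex m l)) x y :
  same_block (diagram_of e) x y = connect (symclos e) x y.
Proof.
rewrite /same_block /= pblock_equivalence_partition ?inE //.
move=> {}x {}y z _ _ _; split; first exact: connect0.
by move=> xy; apply: (same_connect (@symclos_connect_sym _ _)).
Qed.

Lemma image_rel_img (S T : finType) (f : S -> T) (r : rel S) u v :
  r u v -> image_rel f r (f u) (f v).
Proof.
move=> ruv; apply/existsP; exists u; apply/existsP; exists v.
by rewrite ruv !eqxx.
Qed.

(* A diagram is determined by the two-colourings of its vertices that are    *)
(* constant on blocks; in these terms stacking becomes the composition of    *)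
(* relations.                                                                *)
Definition colour m l (a : 'I_m -> bool) (b : 'I_l -> bool) (x : vertex m l) :=
  match x with inl i => a i | inr j => b j end.

Definition compat m l (D : diagram m l) a b : Prop :=
  forall x y, same_block D x y -> colour a b x = colour a b y.

Lemma connect_const (T : finType) (U : Type) (e : rel T) (c : T -> U) :
  (forall x y, e x y -> c x = c y) ->
  forall x y, connect (symclos e) x y -> c x = c y.
Proof.
move=> ec x y /connectP[p]; elim: p x => [|z p IH] x /= => [_ -> //|].
by case/andP=> /orP[/ec->|/ec<-] /IH; apply.
Qed.

Lemma compat_diagram_of m l (e : rel (vertex m l)) a b :
  compat (diagram_of e) a b <->
  forall x y, e x y -> colour a b x = colour a b y.
Proof.
split=> [h x y exy|h x y].
  by apply: h; rewrite same_block_diagram_of connect1 // /symclos exy.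
by rewrite same_block_diagram_of; apply: connect_const.
Qed.

(** The separating colouring is the indicator function of the block of [x]. *)
Lemma same_blockE m l (D : diagram m l) x y :
  same_block D x y <->
  forall a b, compat D a b -> colour a b x = colour a b y.
Proof.
split=> [xy a b|h]; first by apply.
have [xx sym] := (same_block_refl D x, same_block_sym D).
pose c z := same_block D x z.
have cE z : colour (fun i => c (inl i)) (fun j => c (inr j)) z = c z by case: z.
have := h (fun i => c (inl i)) (fun j => c (inr j)).
rewrite !cE /c xx => <- // z t zt; rewrite !cE /c.
by rewrite sym (same_block_trans zt) sym.
Qed.

Lemma compat_inj m l (D D' : diagram m l) :
  (forall a b, compat D a b <-> compat D' a b) -> D = D'.
Proof.
move=> h; have sE x y : same_block D x y = same_block D' x y.
  by apply/idP/idP => /same_blockE s; apply/same_blockE => a b /h /s.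
have canon (E : diagram m l) :
    val E = equivalence_partition (same_block E) [set: vertex m l].
  have /and3P[/eqP cov tri n0] := valP E.
  apply/setP => B; apply/idP/imsetP => [BE|[x _ ->]].
    have /set0Pn[x xB] : B != set0 by apply: contraNneq n0 => <-.
    exists x => //; apply/setP => y; rewrite !inE /same_block.
    by rewrite (def_pblock tri BE xB).
  suff -> : [set y in [set: vertex m l] | same_block E x y] = pblock (val E) x.
    by rewrite pblock_mem // cov inE.
  by apply/setP => y; rewrite !inE.
apply: val_inj; rewrite !canon; congr (equivalence_partition _ _).
by apply/funext => x; apply/funext => y.
Qed.

Section StackCompat.
Variables (m l k : nat) (D : diagram l k) (D' : diagram m l).

Lemma stack_const (a : 'I_m -> bool) (z : 'I_l -> bool) (b : 'I_k -> bool) :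
  compat D' a z -> compat D z b ->
  forall u v, connect (symclos (stack D D')) u v ->
    match u with inl x => colour a z x | inr j => b j end =
    match v with inl x => colour a z x | inr j => b j end.
Proof.
move=> h' h; apply: connect_const => u v; rewrite /stack /image_rel.
case/orP=> /existsP[x /existsP[y /and3P[xy /eqP-> /eqP->]]].
  exact: h' xy.
by have := h _ _ xy; case: x {xy} => x; case: y => y.
Qed.

Lemma compat_star a b :
  compat (star D D') a b <-> exists z, compat D' a z /\ compat D z b.
Proof.
pose s := stack D D'.
have sym := @symclos_connect_sym _ s.
split=> [/compat_diagram_of h|[z [h' h]]]; last first.
  apply/compat_diagram_of => x y /(stack_const h' h).
  by case: x => x; case: y.
(* The colouring is extended to the middle row: a vertex is true iff it is connected to some outer
   vertex coloured true. Closed components thereby become false. *)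
pose c (u : stack_vertex m l k) :=
  [exists x, connect (symclos s) (outer l x) u && colour a b x].
have cK x : c (outer l x) = colour a b x.
  apply/existsP/idP => [[y /andP[yx]]|bx]; first by rewrite (h _ _ yx).
  by exists x; rewrite connect0.
have cKl i : c (inl (inl i)) = a i := cK (inl i).
have cKr i : c (inr i) = b i := cK (inr i).
have cc u v : connect (symclos s) u v -> c u = c v.
  by move=> uv; apply: eq_existsb => x; rewrite sym (same_connect sym uv) sym.
have edge u v : s u v -> c u = c v.
  by move=> suv; apply/cc/connect1; rewrite /symclos suv.
exists (fun i => c (inl (inr i))); split=> x y xy.
  have /edge : s (lower k x) (lower k y).
    by apply/orP; left; apply: image_rel_img.
  by case: x {xy} => x; case: y => y; rewrite /= ?cKl.
have /edge : s (upper m x) (upper m y).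
  by apply/orP; right; apply: image_rel_img.
by case: x {xy} => x; case: y => y; rewrite /= ?cKr.
Qed.

(** Every middle vertex is then joined directly to an outer one, so no component stays inside the
    middle row. *)
Lemma alpha_eq0 :
  (forall i : 'I_l, (exists y, same_block D (inl i) (inr y)) \/
                    (exists x, same_block D' (inr i) (inl x))) ->
  alpha D D' = 0%N.
Proof.
move=> h; apply: eq_card0 => C; rewrite !inE;
  apply/negP => /andP[CP /subsetP Cm].
have /and3P[_ tri n0] := components_partition (stack D D').
have /set0Pn[u uC] : C != set0 by apply: contraNneq n0 => <-.
have conn v : connect (symclos (stack D D')) u v -> v \in C.
  move=> uv; rewrite -(def_pblock tri CP uC)
    pblock_equivalence_partition ?inE //.
  move=> {uv} x y z _ _ _; split; first exact: connect0.
  by move=> xy; apply: (same_connect (@symclos_connect_sym _ _)).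
have /imsetP[i _ ui] := Cm _ uC.
suff [v] : exists v : vertex m k, connect (symclos (stack D D')) u (outer l v).
  by case: v => v /conn/Cm/imsetP[].
case: (h i) => [[y iy]|[x ix]].
  exists (inr y); rewrite ui; apply/connect1/orP; left; apply/orP; right.
  exact (image_rel_img (@upper m l k) iy).
exists (inl x); rewrite ui; apply/connect1/orP; left; apply/orP; left.
exact (image_rel_img (@lower m l k) ix).
Qed.
End StackCompat.

Lemma compat_juxtapose m l m' l' (D : diagram m l) (D' : diagram m' l') a b :
  compat (juxtapose D D') a b <->
  compat D (fun i => a (lshift m' i)) (fun j => b (lshift l' j)) /\
  compat D' (fun i => a (rshift m i)) (fun j => b (rshift l j)).
Proof.
rewrite compat_diagram_of; split=> [h|[h h'] x y].
  split=> x y xy.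
    have := h (lvertex m' l' x) (lvertex m' l' y).
    by rewrite image_rel_img // => /(_ isT); case: x {xy} => x; case: y.
  have := h (rvertex m l x) (rvertex m l y).
  by rewrite orbC image_rel_img // => /(_ isT); case: x {xy} => x; case: y.
case/orP=> /existsP[u /existsP[v /and3P[uv /eqP-> /eqP->]]].
  by have := h _ _ uv; case: u {uv} => u; case: v.
by have := h' _ _ uv; case: u {uv} => u; case: v.
Qed.

Lemma compat_id m a b : compat (id_diagram m) a b <-> a =1 b.
Proof.
rewrite compat_diagram_of; split=> [h i|h [] i [] j //= /eqP->]; last exact: h.
exact: (h (inl i) (inr i)).
Qed.

Lemma compat_one_block m l a b :
  compat (one_block m l) a b <-> forall x y, colour a b x = colour a b y.
Proof. by rewrite compat_diagram_of; split=> h x y => [|_]; apply: h. Qed.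

Lemma compat_swap a b :
  compat swap_diagram a b <-> forall i, a i = b (rev_ord i).
Proof.
rewrite compat_diagram_of; split=> [h i|h [] i [] j //= /eqP->]; last exact: h.
exact: (h (inl i) (inr (rev_ord i))).
Qed.

(** * Diagrams obtained from the elementary ones *)

(** The condition on [alpha] makes the composite in [Par] equal to the stacked diagram with
    coefficient 1; a positive power of n could not be divided out over a general ring. *)
Inductive generated : forall m l, diagram m l -> Prop :=
| gen_id m : generated (id_diagram m)
| gen_mu : generated (one_block 2 1)
| gen_delta : generated (one_block 1 2)
| gen_eta : generated (one_block 0 1)
| gen_epsilon : generated (one_block 1 0)
| gen_swap : generated swap_diagram
| gen_star m l k (D : diagram l k) (D' : diagram m l) :
    alpha D D' = 0%N -> generated D -> generated D' -> generated (star D D')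
| gen_juxtapose m l m' l' (D : diagram m l) (D' : diagram m' l') :
    generated D -> generated D' -> generated (juxtapose D D').

Lemma gen_units k :
  exists2 D : diagram 0 k, generated D & forall a b, compat D a b.
Proof.
elim: k => [|k [D gD D_]].
  exists (id_diagram 0); first exact: gen_id.
  by move=> a b; apply/compat_id => -[].
exists (juxtapose (one_block 0 1) D : diagram 0 k.+1).
  exact: gen_juxtapose gen_eta gD.
move=> a b; apply/(@compat_juxtapose 0 1 0 k); split; last exact: D_.
by apply/compat_one_block => -[[]//|x] [[]//|y]; rewrite !ord1.
Qed.

Lemma gen_counits k :
  exists2 D : diagram k 0, generated D & forall a b, compat D a b.
Proof.
elim: k => [|k [D gD D_]].
  exists (id_diagram 0); first exact: gen_id.
  by move=> a b; apply/compat_id => -[].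
exists (juxtapose (one_block 1 0) D : diagram k.+1 0).
  exact: gen_juxtapose gen_epsilon gD.
move=> a b; apply/(@compat_juxtapose 1 0 k 0); split; last exact: D_.
by apply/compat_one_block => -[x|[]//] [y|[]//]; rewrite !ord1.
Qed.

Lemma alpha_eq0_through m l k (D : diagram l k) (D' : diagram m l) f :
  (forall a b, compat D a b -> forall i, a i = b (f i)) -> alpha D D' = 0%N.
Proof.
move=> h; apply: alpha_eq0 => i; left; exists (f i); apply/same_blockE => a b.
by move/h => /(_ i).
Qed.

Lemma gen_cons k l (D : diagram k l) : generated D ->
  exists2 D' : diagram k.+1 l.+1, generated D' &
   forall a b, compat D' a b <->
     a ord0 = b ord0 /\
     compat D (fun i => a (lift ord0 i)) (fun i => b (lift ord0 i)).
Proof.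
move=> gD; exists (juxtapose (id_diagram 1) D).
  exact: gen_juxtapose (gen_id 1) gD.
have E n (i : 'I_n) : rshift 1 i = lift ord0 i :> 'I_n.+1 by apply: val_inj.
have E0 n : lshift n (ord0 : 'I_1) = ord0 :> 'I_n.+1 by apply: val_inj.
move=> a b; rewrite (@compat_juxtapose 1 1 k l) compat_id.
under [fun i => a (rshift 1 i)]funext => i do rewrite E.
under [fun i => b (rshift 1 i)]funext => i do rewrite E.
split=> -[h1 h2]; split=> //; first by have := h1 ord0; rewrite !E0.
by move=> i; rewrite ord1 !E0.
Qed.

Lemma compat_cons2 k l (D : diagram 2 2) (D' : diagram k l) a b :
  compat (juxtapose D D' : diagram k.+2 l.+2) a b <->
  compat D (fun i => a (lshift k i)) (fun i => b (lshift l i)) /\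
  compat D' (fun i => a (lift ord0 (lift ord0 i)))
            (fun i => b (lift ord0 (lift ord0 i))).
Proof.
rewrite (@compat_juxtapose 2 2 k l).
have E n (i : 'I_n) : rshift 2 i = lift ord0 (lift ord0 i) :> 'I_n.+2.
  exact: val_inj.
under [fun i => a (rshift 2 i)]funext => i do rewrite E.
by under [fun i => b (rshift 2 i)]funext => i do rewrite E.
Qed.

Lemma forall_ord2 (P : 'I_2 -> Prop) : P ord0 -> P ord_max -> forall i, P i.
Proof.
move=> P0 P1 i; have : i \in enum 'I_2 by rewrite mem_enum.
by rewrite !enum_ordSl enum_ord0 !inE => /orP[]/eqP->;
  rewrite // (_ : lift _ _ = ord_max) //; apply: val_inj.
Qed.

Lemma forall_ordS2 k (P : 'I_k.+2 -> Prop) :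
  P ord0 -> P (lift ord0 ord0) -> (forall i, P (lift ord0 (lift ord0 i))) ->
  forall i, P i.
Proof.
move=> P0 P1 P2 i; case: (unliftP ord0 i) => [i' ->|-> //].
by case: (unliftP ord0 i') => [i'' ->|-> //].
Qed.

Lemma gen_swap_first k : exists2 D : diagram k.+2 k.+2, generated D &
  forall a b, compat D a b <->
    [/\ a ord0 = b (lift ord0 ord0), a (lift ord0 ord0) = b ord0 &
        forall i, a (lift ord0 (lift ord0 i)) = b (lift ord0 (lift ord0 i))].
Proof.
exists (juxtapose swap_diagram (id_diagram k) : diagram k.+2 k.+2).
  exact (gen_juxtapose gen_swap (gen_id k)).
move=> a b; rewrite compat_cons2 compat_swap compat_id.
have E0 : lshift k (ord0 : 'I_2) = ord0 :> 'I_k.+2 by apply: val_inj.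
have E1 : lshift k (ord_max : 'I_2) =
  lift ord0 ord0 :> 'I_k.+2 by apply: val_inj.
have r0 : rev_ord (ord0 : 'I_2) = ord_max by apply: val_inj.
have r1 : rev_ord (ord_max : 'I_2) = ord0 by apply: val_inj.
split=> [[h1 h2]|[h0 h1 h2]].
  by have := h1 ord0; have := h1 ord_max; rewrite r0 r1 E0 E1.
by split=> //; apply: forall_ord2; rewrite ?r0 ?r1 E0 E1.
Qed.

(** Realised by delta after mu, beside k idle strands. *)
Lemma gen_merge_first k : exists2 D : diagram k.+2 k.+2, generated D &
  forall a b, compat D a b <-> a =1 b /\ a ord0 = a (lift ord0 ord0).
Proof.
exists (juxtapose (star (one_block 1 2) (one_block 2 1)) (id_diagram k)
        : diagram k.+2 k.+2).
  refine (gen_juxtapose (gen_star _ gen_delta gen_mu) (gen_id k)).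
  apply: (@alpha_eq0_through _ _ _ _ _ (fun=> ord0)) => a b.
  by move=> /compat_one_block h i; apply: (h (inl i) (inr ord0)).
move=> a b; rewrite compat_cons2 compat_star compat_id.
have E0 : lshift k (ord0 : 'I_2) = ord0 :> 'I_k.+2 by apply: val_inj.
have E1 : lshift k (ord_max : 'I_2) =
  lift ord0 ord0 :> 'I_k.+2 by apply: val_inj.
split=> [[[z [/compat_one_block h1 /compat_one_block h2]] h3]|[ab a01]].
  have z1 (i : 'I_2) : a (lshift k i) = z ord0 := h1 (inl i) (inr ord0).
  have z2 (i : 'I_2) : z ord0 = b (lshift k i) := h2 (inl ord0) (inr i).
  have := z1 ord0; have := z1 ord_max; have := z2 ord0; have := z2 ord_max.
  rewrite E0 E1 => b1 b0 a1 a0; split; last by rewrite a0 a1.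
  by apply: forall_ordS2 => //; rewrite ?a0 ?a1.
split; last by move=> i; apply: ab.
have c : forall i : 'I_2, a (lshift k i) = a ord0.
  by apply: forall_ord2; rewrite ?E0 ?E1.
by exists (fun=> a ord0); split; apply/compat_one_block => -[x|x] [y|y] /=;
  rewrite -?ab ?c.
Qed.

(** Induction on the number of strands: a pair avoiding strand 0 is merged beside an idle strand,
    and a pair containing strand 0 is either the first two strands or conjugate, by a swap, to a
    pair avoiding strand 0. *)
Lemma gen_merge k (i j : 'I_k) : exists2 D : diagram k k, generated D &
  forall a b, compat D a b <-> a =1 b /\ a i = a j.
Proof.
elim: k i j => [|k IH] i j; first by case: i.
suff main (j' : 'I_k) : exists2 D : diagram k.+1 k.+1, generated D &
    forall a b, compat D a b <-> a =1 b /\ a ord0 = a (lift ord0 j').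
  case: (unliftP ord0 i) => [i' ->|->]; case: (unliftP ord0 j) => [j' ->|->].
  - have [D gD DE] := IH i' j'; have [D' gD' D'E] := gen_cons gD.
    exists D' => // a b; rewrite D'E DE; split=> [[h0 [h1 h2]]|[h1 h2]].
      by split=> // x; case: (unliftP ord0 x) => [x' ->|->].
    by split=> //; split=> // x; apply: h1.
  - by have [D gD DE] := main i'; exists D => // a b; rewrite DE; split=> -[].
  - exact: main.
  - exists (id_diagram k.+1); first exact: gen_id.
    by move=> a b; rewrite compat_id; split=> // -[].
case: k {i j} j' IH => [[]//|k] j' IH.
case: (unliftP ord0 j') => [l ->|->]; last exact: gen_merge_first.
(* Conjugate the merging of strands 1 and l + 2 by the swap of strands 0, 1. *)
have [D gD DE] := IH ord0 (lift ord0 l); have [M gM ME] := gen_cons gD.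
have [T gT TE] := gen_swap_first k.
have through a b : compat T a b -> forall i,
    a i = b (tperm ord0 (lift ord0 ord0) i).
  case/TE=> h0 h1 h2; apply: forall_ordS2; rewrite ?tpermL ?tpermR // => x.
  by rewrite tpermD.
have throughM a b : compat M a b -> forall i, a i = b i.
  case/ME=> h0 /DE[h1 h2] x.
  by case: (unliftP ord0 x) => [x' ->|->].
exists (star T (star M T)).
  apply: gen_star => //; first exact: alpha_eq0_through through.
  by apply: gen_star => //; apply: alpha_eq0_through throughM.
move=> a b; rewrite compat_star; split.
  case=> z [/compat_star[y [/TE[a0 a1 a2] /[dup] /throughM yz
    /ME[_ /DE[_ y1]]]]].
  case/TE=> z0 z1 z2; split; last by rewrite a0 y1 a2.
  by apply: forall_ordS2; rewrite ?a0 ?a1 ?yz // => x; rewrite a2 yz.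
case=> ab a0.
pose z i := a (tperm ord0 (lift ord0 ord0) i).
have z0 : z ord0 = a (lift ord0 ord0) by rewrite /z tpermL.
have z1 : z (lift ord0 ord0) = a ord0 by rewrite /z tpermR.
have z2 x : z (lift ord0 (lift ord0 x)) = a (lift ord0 (lift ord0 x)).
  by rewrite /z tpermD.
exists z; split; last by apply/TE; rewrite z0 z1; split=> // x; rewrite z2.
apply/compat_star; exists z; split; first by apply/TE; rewrite z0 z1;
  split=> // x; rewrite z2.
by apply/ME; split=> //; apply/DE; split=> //; rewrite z1 z2.
Qed.

Lemma gen_merges k (s : seq ('I_k * 'I_k)) :
  exists2 D : diagram k k, generated D &
  forall a b, compat D a b <-> a =1 b /\ forall p, p \in s -> a p.1 = a p.2.
Proof.
elim: s => [|[i j] s [D gD DE]].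
  exists (id_diagram k); first exact: gen_id.
  by move=> a b; rewrite compat_id; split=> // -[].
have [M gM ME] := gen_merge i j; exists (star M D).
  apply: gen_star => //; apply: (@alpha_eq0_through _ _ _ _ _ id).
  by move=> a b /ME[].
move=> a b; rewrite compat_star; split.
  case=> z [/DE[az h] /ME[zb zij]]; split=> [x|p]; first by rewrite az zb.
  by rewrite inE => /orP[/eqP-> /=|/h//]; rewrite !az.
case=> ab h; exists a; split.
  by apply/DE; split=> // p ps; apply: h; rewrite inE ps orbT.
by apply/ME; split=> //; apply: (h (i, j)); rewrite inE eqxx.
Qed.

Lemma gen_left_proj l m : exists2 D : diagram (l + m) l, generated D &
  forall a b, compat D a b <-> forall i, a (lshift m i) = b i.
Proof.
elim: l => [|l [D gD DE]].
  have [D gD D_] := gen_counits m; exists D => // a b.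
  by split=> // _ [].
have [D' gD' D'E] := gen_cons gD; exists D' => // a b; rewrite D'E DE.
have E0 : lshift m (ord0 : 'I_l.+1) = ord0 :> 'I_(l + m).+1 by apply: val_inj.
have ES i : lshift m (lift ord0 i : 'I_l.+1) =
  lift ord0 (lshift m i) :> 'I_(l + m).+1.
  exact: val_inj.
split=> [[h0 h1] i|h]; last by rewrite -h E0; split=> // i; rewrite -h ES.
by case: (unliftP ord0 i) => [i' ->|->]; rewrite ?E0 // ES.
Qed.

(* Put m idle strands next to l new ones, merge the l + m strands according  *)
(* to the blocks of D, and forget the m strands on top.                      *)
Lemma diagram_generated m l (D : diagram m l) : generated D.
Proof.
have [U gU U_] := gen_units l; have [A gA AE] := gen_left_proj l m.
pose B : diagram m (l + m) := juxtapose U (id_diagram m).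
have BE a b : compat B a b <-> forall i, a i = b (rshift l i).
  rewrite (@compat_juxtapose 0 l m m) compat_id.
  have E i : rshift 0 i = i :> 'I_m by apply: val_inj.
  by split=> [[_ h] i|h]; [rewrite -h E|split=> // i; rewrite -h E].
(* The l + m middle strands seen as vertices of [D]: the first l are its top vertices, the last m
   its bottom ones. *)
pose f (i : 'I_(l + m)) : vertex m l :=
  match split i with inl x => inr x | inr x => inl x end.
have fl x : f (lshift m x) = inr x by rewrite /f (unsplitK (inl x)).
have fr x : f (rshift l x) = inl x by rewrite /f (unsplitK (inr x)).
pose s := [seq p : 'I_(l + m) * 'I_(l + m) <- enum {: 'I_(l + m) * 'I_(l + m)}
  | same_block D (f p.1) (f p.2)].
have [E gE EE] := gen_merges s.
have EB a b : compat (star E B) a b <->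
   (forall i, a i = b (rshift l i)) /\ forall p, p \in s -> b p.1 = b p.2.
  rewrite compat_star; split=> [[z [/BE az /EE[zb h]]]|[h hs]].
    by split=> [i|p /h]; rewrite ?az ?zb.
  by exists b; split; [apply/BE|apply/EE].
suff -> : D = star A (star E B).
  apply: gen_star => //; last first.
    apply: gen_star => //; last exact (gen_juxtapose gU (gen_id m)).
    by apply: (@alpha_eq0_through _ _ _ _ _ id) => a b /EE[].
  (* The first l strands continue to the top through [A], the last m come from the bottom through
     [B]. *)
  apply: alpha_eq0 => i; case: (split_ordP i) => x ->; [left|right]; exists x;
    apply/same_blockE => a b.
    by move/AE/(_ x).
  by case/EB=> /(_ x).
apply: compat_inj => a b; rewrite compat_star; split.
  move=> h; pose z i := colour a b (f i); exists z; split.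
    apply/EB; split=> [i|p]; first by rewrite /z fr.
    by rewrite mem_filter => /andP[/h].
  by apply/AE => i; rewrite /z fl.
case=> z [/EB[az hs] /AE zb].
have cE i : colour a b (f i) = z i.
  by rewrite /f; case: split_ordP => x -> /=.
have fK x : exists i, f i = x.
  by case: x => x; [exists (rshift l x)|exists (lshift m x)].
move=> x y; have [[i <-] [j <-]] := (fK x, fK y) => xy.
by rewrite !cE; apply: (hs (i, j)); rewrite mem_filter xy mem_enum.
Qed.

(** * Permutations and tensor products *)

Section Perms.
Variable n : nat.
Implicit Types g h : 'S_n.

Lemma pcompE g h i : (g ∘p h) i = g (h i).
Proof. exact: permM. Qed.

Lemma pcomp1g g : 1%g ∘p g = g. Proof. exact: mulg1. Qed.

Lemma pcompg1 g : g ∘p 1%g = g. Proof. exact: mul1g. Qed.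

Lemma pcompgV g : g ∘p g^-1%g = 1%g. Proof. exact: mulVg. Qed.

Lemma pcompVg g : g^-1%g ∘p g = 1%g. Proof. exact: mulgV. Qed.

Lemma pcompVK g h : g^-1%g ∘p (g ∘p h) = h.
Proof. by rewrite pcompA pcompVg pcomp1g. Qed.

Lemma pcompKV g h : g ∘p (g^-1%g ∘p h) = h.
Proof. by rewrite pcompA pcompgV pcomp1g. Qed.

Lemma emb_id g : emb n g = g.
Proof. by apply/permP => i; apply: val_inj; rewrite embE // extendE. Qed.
End Perms.

Lemma embV m n (g : 'S_m) : (m <= n)%N -> emb n g^-1%g = (emb n g)^-1%g.
Proof.
move=> le_mn; rewrite -[LHS]pcompg1 -(pcompgV (emb n g)) pcompA -embM //.
by rewrite pcompVg emb1 // pcomp1g.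
Qed.

Lemma emb_max n (s : 'S_n) : emb n.+1 s ord_max = ord_max.
Proof. by apply: val_inj; rewrite embE //= extend_out. Qed.

(** S_n is the stabiliser of the last point. With [coset_repE], this factors any permutation through
    its coset representative. *)
Lemma fix_max_emb n (g : 'S_n.+1) :
  g ord_max = ord_max -> exists s : 'S_n, g = emb n.+1 s.
Proof.
move=> gm; have lt_g (i : 'I_n) : (g (widen_ord (leqnSn n) i) < n)%N.
  rewrite ltn_neqAle -ltnS ltn_ord andbT; apply/eqP => e.
  have : g (widen_ord (leqnSn n) i) = g ord_max by rewrite gm; apply: val_inj.
  by move/perm_inj/(congr1 val) => /= ie; have := ltn_ord i; rewrite ie ltnn.
have inj : injective (fun i => Ordinal (lt_g i)).
  by move=> i j /(congr1 val) /= /val_inj/perm_inj/(congr1 val) /= /val_inj.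
exists (perm inj); apply/permP => i; apply: val_inj; rewrite embE //.
case: (ltnP i n) => [lt_in|le_ni].
  rewrite (extendE _ (Ordinal lt_in)) permE /=; congr (val (g _)).
  exact: val_inj.
have -> : i = ord_max.
  by apply/val_inj/eqP; rewrite /= eqn_leq le_ni -ltnS ltn_ord.
by rewrite gm extend_out.
Qed.

Lemma coset_rep_max n : coset_rep (ord_max : 'I_n.+1) = 1%g.
Proof. by rewrite /coset_rep subnn. Qed.

Lemma coset_repE n (i : 'I_n.+1) : coset_rep i ord_max = i.
Proof.
have main d j : (j + d <= n)%N ->
    foldr (@pcomp n.+1) 1%g [seq adj n.+1 k | k <- iota j d] (inord (j + d)) =
    inord j.
  elim: d j => [|d IH] j le_n /=; first by rewrite perm1 addn0.
  by rewrite pcompE -addSnnS IH ?addSnnS // tpermR.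
have le_in : (i <= n)%N by rewrite -ltnS.
have := main (n - i)%N i; rewrite subnKC // inord_val => /(_ (leqnn n)) {2}<-.
by congr (fun_of_perm _ _); apply: val_inj; rewrite /= inordK.
Qed.

Lemma emb_widen m (g : 'S_m) (i : 'I_m) :
  emb m.+1 g (widen_ord (leqnSn m) i) = widen_ord (leqnSn m) (g i).
Proof. by apply: val_inj; rewrite embE //= extendE. Qed.

Lemma widen_neq_max m (i : 'I_m) : widen_ord (leqnSn m) i != ord_max.
Proof. by rewrite -val_eqE /= neq_ltn ltn_ord. Qed.

Section LastTransposition.
Variable n : nat.
Let s : 'S_n.+2 := adj n.+2 n.

Lemma last_adjK : s ∘p s = 1%g.
Proof. exact: tperm2. Qed.

Lemma last_adjV : s^-1%g = s.
Proof. exact: tpermV. Qed.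

Lemma last_adj_max : s ord_max = widen_ord (leqnSn n.+1) ord_max.
Proof.
have -> : ord_max = inord n.+1 :> 'I_n.+2 by apply: val_inj; rewrite /= inordK.
by rewrite /s /adj tpermR; apply: val_inj; rewrite /= inordK.
Qed.
End LastTransposition.

Section TensorLift.
Variables (R : comPzRingType) (K : choiceType) (d : K -> nat).
Variables (M N : K -> lmodType R) (P : lmodType R).
Variable r : forall k, 'S_(d k) -> {linear M k -> M k}.
Variable l : forall k, 'S_(d k) -> {linear N k -> N k}.
Variable f : forall k, M k -> N k -> P.
Hypothesis f_linl : forall k v, linear (f (k := k) ^~ v).
Hypothesis f_linr : forall k u, linear (f (k := k) u).
Hypothesis f_bal : forall k g (u : M k) v, f (r g u) v = f u (l g v).

Definition lift_seq (s : seq (pure M N)) : P :=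
  \sum_(p <- s) f (tagged p).1 (tagged p).2.

Lemma lift_seq_teq s s' : teq r l s s' -> lift_seq s = lift_seq s'.
Proof using f_linl f_linr f_bal.
pose fl k v : {linear M k -> P} :=
  HB.pack (f (k := k) ^~ v) (GRing.isLinear.Build _ _ _ _ _ (@f_linl k v)).
pose fr k u : {linear N k -> P} :=
  HB.pack (f (k := k) u) (GRing.isLinear.Build _ _ _ _ _ (@f_linr k u)).
elim=> {s s'} [//|//|s s' s'' _ -> _ -> //|s s' p p' _ h _ h'|s s'|k v|
  k u u' v|k u v v'|k y u v|k g u v];
  rewrite /lift_seq ?big_cat ?(big_cons, big_nil) ?addr0 /=.
- by congr (_ + _).
- exact: addrC.
- exact: (linear0 (fl k v)).
- exact: (linearD (fl k v)).
- exact: (linearD (fr k u)).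
- by rewrite [LHS](linearZ_LR (fl k v)) [RHS](linearZ_LR (fr k u)).
- exact: f_bal.
Qed.

Definition tensor_lift_fun (a : tensor r l) : P :=
  lift_seq (generic_quotient.repr a).

Lemma tensor_lift_funE s : tensor_lift_fun (\pi_(tensor r l)%qT s) = lift_seq s.
Proof using f_linl f_linr f_bal.
by apply/lift_seq_teq/tensor_eqP; rewrite reprK.
Qed.

Lemma tensor_lift_linear : linear tensor_lift_fun.
Proof using f_linl f_linr f_bal.
move=> x a b; elim/tensorW: a => a; elim/tensorW: b => b.
rewrite [_ *: _]tens_scaleE [_ + _]tens_addE !tensor_lift_funE.
rewrite /lift_seq big_cat big_map /= scaler_sumr; congr (_ + _).
apply: eq_bigr => -[k [u v]] _ /=.
pose fl : {linear M k -> P} :=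
  HB.pack (f (k := k) ^~ v) (GRing.isLinear.Build _ _ _ _ _ (@f_linl k v)).
exact: (linearZ_LR fl).
Qed.

(** The universal property of the balanced tensor product; it serves to build the functionals dual
    to the images of beta. *)
Definition tensor_lift : {linear tensor r l -> P} :=
  HB.pack tensor_lift_fun (GRing.isLinear.Build _ _ _ _ _ tensor_lift_linear).

Lemma tensor_liftE k (u : M k) (v : N k) :
  tensor_lift (tpure r l k u v) = f u v.
Proof using. by rewrite [LHS]tensor_lift_funE /lift_seq big_seq1. Qed.
End TensorLift.

Section PermBimodTheory.
Variables (R : comPzRingType) (N n m : nat) (b : bool).
Hypothesis le_N : b -> (n <= N)%N && (m <= N)%N.
Let M := perm_bimod R le_N.

Lemma perm_lactE g h : lact M g (pvec R b h) = pvec R b (emb N g ∘p h).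
Proof.
apply/ffunP => x; rewrite !ffunE /=; have /andP[le_nN _] := le_N (valP x).
congr (_ %:R); congr (nat_of_bool _); rewrite embV //.
by apply/eqP/eqP => [<-|->]; rewrite ?pcompKV ?pcompVK.
Qed.

Lemma perm_ractE g h : ract M g (pvec R b h) = pvec R b (h ∘p emb N g).
Proof.
apply/ffunP => x; rewrite !ffunE /=; have /andP[_ le_mN] := le_N (valP x).
congr (_ %:R); congr (nat_of_bool _); rewrite embV //.
by apply/eqP/eqP => [<-|->]; rewrite -pcompA ?pcompgV ?pcompVg pcompg1.
Qed.
End PermBimodTheory.

Section PermMod.
Variables (R : comPzRingType) (N : nat) (b : bool).

Lemma perm_mod0 (v : perm_mod R N b) : b = false -> v = 0.
Proof. by move=> b0; apply/ffunP => x; have /= := valP x; rewrite {1}b0. Qed.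

Lemma perm_mod_ind (P : perm_mod R N b -> Prop) :
  P 0 -> (forall u v, P u -> P v -> P (u + v)) ->
  (forall x u, P u -> P (x *: u)) -> (b -> forall g, P (pvec R b g)) ->
  forall v, P v.
Proof.
move=> P0 PD PZ P1 v.
have -> : v = \sum_x v x *: pvec R b (val x).
  apply/ffunP => y; rewrite sum_ffunE (bigD1 y) //= big1 => [|x ne_xy].
    by rewrite !ffunE eqxx addr0 [RHS]mulr1.
  by rewrite !ffunE (inj_eq val_inj) eq_sym (negbTE ne_xy) [LHS]mulr0.
elim/big_ind: _ => // x _; apply/PZ/P1; exact: valP x.
Qed.

(** The augmentation of the group algebra, from which the functionals dual to the w_i start. *)
Definition coef_sum (v : perm_mod R N b) : R^o := \sum_x v x.

Lemma coef_sum_linear : linear coef_sum.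
Proof.
move=> a u v; rewrite /coef_sum scaler_sumr -big_split.
by apply: eq_bigr => x _; rewrite !ffunE.
Qed.

Lemma coef_sum_pvec g : b -> coef_sum (pvec R b g) = 1.
Proof.
move=> bT; rewrite /coef_sum (bigD1 (exist _ g bT : perms N b)) //= big1.
  by rewrite ffunE eqxx addr0.
by move=> x; rewrite ffunE -val_eqE => /negbTE ->.
Qed.
End PermMod.

Section FamilyTheory.
Variable R : comPzRingType.

Lemma lact_vId n (g h : 'S_n) :
  lact (fam_Id R n n) g (vId n h) = vId n (g ∘p h).
Proof. by rewrite [LHS]perm_lactE emb_id. Qed.

Lemma ract_vId n (g h : 'S_n) :
  ract (fam_Id R n n) g (vId n h) = vId n (h ∘p g).
Proof. by rewrite [LHS]perm_ractE emb_id. Qed.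

Lemma lact_vUp n (g h : 'S_n.+1) :
  lact (fam_Up R n.+1 n) g (vUp n h) = vUp n (g ∘p h).
Proof. by rewrite [LHS]perm_lactE emb_id. Qed.

Lemma ract_vUp n (g : 'S_n) (h : 'S_n.+1) :
  ract (fam_Up R n.+1 n) g (vUp n h) = vUp n (h ∘p emb n.+1 g).
Proof. by rewrite [LHS]perm_ractE. Qed.

Lemma lact_vDown n (g : 'S_n) (h : 'S_n.+1) :
  lact (fam_Down R n n.+1) g (vDown n h) = vDown n (emb n.+1 g ∘p h).
Proof. by rewrite [LHS]perm_lactE. Qed.

Lemma ract_vDown n (g h : 'S_n.+1) :
  ract (fam_Down R n n.+1) g (vDown n h) = vDown n (h ∘p g).
Proof. by rewrite [LHS]perm_ractE emb_id. Qed.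
End FamilyTheory.

Section TensorPure.
Variables (R : comPzRingType) (K : choiceType) (d : K -> nat).
Variables (M N : K -> lmodType R).
Variable r : forall k, 'S_(d k) -> {linear M k -> M k}.
Variable l : forall k, 'S_(d k) -> {linear N k -> N k}.
Variable k : K.
Implicit Types (u : M k) (v : N k).

Lemma tpure_act g u v : tpure r l k (r g u) v = tpure r l k u (l g v).
Proof. exact/tensor_eqP/teq_act. Qed.

Lemma tpure_linl v : linear (tpure r l k ^~ v).
Proof.
move=> x u u'; rewrite [x *: tpure _ _ _ _ _]tens_scaleE [RHS]tens_addE /=.
exact/tensor_eqP/teq_Dl.
Qed.

Lemma tpure_linr u : linear (tpure r l k u).
Proof.
move=> x v v'; rewrite [x *: tpure _ _ _ _ _]tens_scaleE [RHS]tens_addE /=.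
apply/tensor_eqP/(teq_trans (teq_Dr _ _ _ _ _)).
rewrite -cat1s -[in X in teq _ _ _ X]cat1s; apply: teq_cat (teq_refl _ _ _).
exact/teq_sym/teq_Z.
Qed.

Lemma tpure_scale x u v : tpure r l k (x *: u) v = tpure r l k u (x *: v).
Proof. exact/tensor_eqP/teq_Z. Qed.
End TensorPure.

(** * The images of the generators in bimodules *)

Section ThetaTheory.
Variable R : comPzRingType.
Variable T : @linfunctor R (Heis R) (BiFam R) (@Theta_ob R).
Variable phi : forall a b, fhom (ftens (@Theta_ob R a) (@Theta_ob R b))
                                (@Theta_ob R (a ++ b)).
Hypothesis HT : is_Theta T phi.
Notation Th := (@Theta_ob R).

(** The tensor product of vectors, read in the bimodule of the concatenated word. For explicit words
    the concatenation computes, so that factors can be regrouped without casts. *)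
Definition ph a b n m k (u : Th a n k) (v : Th b k m) : Th (a ++ b) n m :=
  phi a b n m (fpure u v).

Section Bilinear.
Variables (a b : word) (n m k : nat).
Implicit Types (u : Th a n k) (v : Th b k m).

Lemma ph_linl v : linear (fun u => ph u v).
Proof.
move=> x u u'; rewrite /ph -linearP; congr (phi _ _ _ _ _).
exact: tpure_linl.
Qed.

Lemma ph_linr u : linear (fun v : Th b k m => ph u v).
Proof.
move=> x v v'; rewrite /ph -linearP; congr (phi _ _ _ _ _).
exact: tpure_linr.
Qed.

Definition phl v : {linear Th a n k -> Th (a ++ b) n m} :=
  HB.pack (fun u => ph u v) (GRing.isLinear.Build _ _ _ _ _ (ph_linl v)).
Definition phr u : {linear Th b k m -> Th (a ++ b) n m} :=
  HB.pack (fun v : Th b k m => ph u v) (GRing.isLinear.Build _ _ _ _ _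
    (ph_linr u)).

Lemma ph0l v : ph (0 : Th a n k) v = 0. Proof. exact: (linear0 (phl v)). Qed.

Lemma ph0r u : ph u (0 : Th b k m) = 0. Proof. exact: (linear0 (phr u)). Qed.

Lemma phDl v : {morph (fun u => ph u v) : x y / x + y}.
Proof. exact: (linearD (phl v)). Qed.

Lemma phDr u : {morph (fun v : Th b k m => ph u v) : x y / x + y}.
Proof. exact: (linearD (phr u)). Qed.

Lemma phZl x u v : ph (x *: u) v = x *: ph u v.
Proof. exact: (linearZ_LR (phl v)). Qed.

Lemma phZr x u v : ph u (x *: v) = x *: ph u v.
Proof. exact: (linearZ_LR (phr u)). Qed.

Lemma ph_suml I r (P : pred I) (F : I -> Th a n k) v :
  ph (\sum_(i <- r | P i) F i) v = \sum_(i <- r | P i) ph (F i) v.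
Proof. exact: (linear_sum (phl v)). Qed.

Lemma ph_sumr I r (P : pred I) u (F : I -> Th b k m) :
  ph u (\sum_(i <- r | P i) F i) = \sum_(i <- r | P i) ph u (F i).
Proof. exact: (linear_sum (phr u)). Qed.

Lemma ph_bal s u v : ph (ract _ s u) v = ph u (lact _ s v).
Proof. by rewrite /ph; congr (phi _ _ _ _ _); apply: tpure_act. Qed.

Lemma lact_ph g u v : lact _ g (ph u v) = ph (lact _ g u) v.
Proof.
rewrite /ph -bfun_lact; congr (phi _ _ _ _ _);
  exact: (ftens_lactE (F := Th a) (G := Th b)).
Qed.

Lemma ract_ph g u v : ract _ g (ph u v) = ph u (ract _ g v).
Proof.
rewrite /ph -bfun_ract; congr (phi _ _ _ _ _);
  exact: (ftens_ractE (F := Th a) (G := Th b)).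
Qed.
End Bilinear.

Lemma ph_ind a b n m (P : Th (a ++ b) n m -> Prop) :
  P 0 -> (forall u v, P u -> P v -> P (u + v)) ->
  (forall k (u : Th a n k) (v : Th b k m), P (ph u v)) -> forall v, P v.
Proof using HT.
move=> P0 PD P1 v; have [g [_ gK]] := phi_iso HT a b.
have <- : phi a b n m (g n m v) = v := gK n m v.
elim/tensor_ind: (g n m v) => [|k u w|x y hx hy]; first by rewrite linear0.
  exact: P1.
by rewrite linearD; apply: PD.
Qed.

Lemma ph_1l b n m g (v : Th b n m) : ph (vId n g : Th [::] n n) v = lact _ g v.
Proof using HT. exact: (phi_unitl HT). Qed.

Lemma ph_1r x n m g (u : Th [:: x] n m) :
  ph u (vId m g : Th [::] m m) = ract _ g u.
Proof using HT. exact: (phi_unitr HT). Qed.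

Lemma ph_fpure x y b n m k (u : Th [:: x] n k) (v : Th (y :: b) k m) :
  @ph [:: x] (y :: b) n m k u v =
  @fpure R (@Theta_arrow R x) (Th (y :: b)) n m k u v.
Proof using HT. exact: (phi_cons1 HT). Qed.

Lemma Th_nil0 k l (v : Th [::] k l) : k != l -> v = 0.
Proof. by move/negbTE; apply: perm_mod0. Qed.

Lemma Up0 k l (v : Th [:: up] k l) : k != l.+1 -> v = 0.
Proof. by move/negbTE; apply: perm_mod0. Qed.

Lemma Down0 k l (v : Th [:: down] k l) : l != k.+1 -> v = 0.
Proof. by move/negbTE; apply: perm_mod0. Qed.

(** A single letter on the left suffices because words are built letter by letter. If [a] is empty,
    associativity amounts to moving a permutation across the tensor sign. *)
Lemma ph_assoc x a b n m k l (u : Th [:: x] n k) (v : Th a k l) (w : Th b l m) :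
  @ph [:: x] (a ++ b) n m k u (ph v w) =
    @ph (x :: a) b n m l (@ph [:: x] a n l k u v) w.
Proof using HT.
case: a v => [|y a] v; last first.
  rewrite [LHS](@ph_fpure _ y (a ++ b)) [RHS]/ph.
  have -> : @ph [:: x] (y :: a) n l k u v = fpure u v by apply: ph_fpure.
  by symmetry; apply: (phi_cons HT).
have [kl|/negbTE nkl] := eqVneq k l; last first.
  by rewrite (Th_nil0 v) ?nkl // ph0l !ph0r ph0l.
move: v; rewrite -{}kl in w *.
elim/perm_mod_ind => [|v v' h h'|z v h|_ g].
- by rewrite ph0l !ph0r ph0l.
- by rewrite phDl !phDr phDl h h'.
- by rewrite phZl !phZr phZl h.
by rewrite [ph _ w]ph_1l [X in ph X w]ph_1r ph_bal.
Qed.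

Lemma T_ph a b a' b' (f : hmor R a b) (f' : hmor R a' b') n m k
    (u : Th a n k) (v : Th a' k m) :
  T _ _ (Htens f f') n m (ph u v) = ph (T _ _ f n k u) (T _ _ f' k m v).
Proof using HT.
rewrite [LHS](Theta_tens HT) /ph; congr (phi _ _ _ _ _).
exact: (ftens_funE (F := Th a) (G := Th a')).
Qed.

Lemma T_id a n m (v : Th a n m) : T _ _ (Hid a) n m v = v.
Proof. exact: (fmap_id T). Qed.

Lemma T_comp a b c (f : hmor R b c) (g : hmor R a b) n m v :
  T _ _ (Hcomp f g) n m v = T _ _ f n m (T _ _ g n m v).
Proof. exact: (fmap_comp T f g). Qed.

Lemma T_add a b (f g : hmor R a b) n m v :
  T _ _ (Hadd f g) n m v = T _ _ f n m v + T _ _ g n m v.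
Proof. exact: (fmap_add T f g). Qed.

Lemma T_scale a b x (f : hmor R a b) n m v :
  T _ _ (Hscale x f) n m v = x *: T _ _ f n m v.
Proof. exact: (fmap_scale T x f). Qed.

Notation Up m g := (vUp m g : Th [:: up] m.+1 m).
Notation Down m g := (vDown m g : Th [:: down] m m.+1).
Notation Id m g := (vId m g : Th [::] m m).

Lemma T_X n (g : 'S_n.+2) (h : 'S_n.+1) :
  T _ _ HX n.+2 n (ph (Up n.+1 g) (Up n h)) =
  ph (Up n.+1 (g ∘p emb n.+2 h ∘p adj n.+2 n)) (Up n 1%g).
Proof using HT.
by rewrite [in LHS]ph_fpure [RHS]ph_fpure; apply: (Theta_X HT).
Qed.

Lemma T_c n : T _ _ Hc n n (Id n 1%g) = ph (Down n 1%g) (Up n 1%g).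
Proof using HT. by rewrite [RHS]ph_fpure [LHS](Theta_c HT) emb1. Qed.

Lemma T_d n (g h : 'S_n.+1) :
  T _ _ Hd n.+1 n.+1 (ph (Up n g) (Down n h)) = Id n.+1 (g ∘p h).
Proof using HT. by rewrite [in LHS]ph_fpure; apply: (Theta_d HT). Qed.

Lemma T_c' n (g : 'S_n.+1) :
  T _ _ Hc' n.+1 n.+1 (Id n.+1 g) =
  \sum_i ph (Up n (coset_rep i)) (Down n ((coset_rep i)^-1%g ∘p g)).
Proof using HT.
by rewrite [LHS](Theta_c' HT); apply: eq_bigr => i _; rewrite [RHS]ph_fpure.
Qed.

Lemma T_d'_in n (g h : 'S_n.+1) (x : 'S_n) : g ∘p h = emb n.+1 x ->
  T _ _ Hd' n n (ph (Down n g) (Up n h)) = Id n x.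
Proof using HT.
by move=> ghx; rewrite [in LHS]ph_fpure; apply: (Theta_d'_in HT).
Qed.

Lemma T_d'_out n (g h : 'S_n.+1) : g (h ord_max) != ord_max ->
  T _ _ Hd' n n (ph (Down n g) (Up n h)) = 0.
Proof using HT.
move=> gh; rewrite [in LHS]ph_fpure; apply: (Theta_d'_out HT) => x ghx.
by move: gh; rewrite -pcompE ghx emb_max eqxx.
Qed.

(** * The crossings l, r and Y on pure tensors *)

(** In the definition of l, c' inserts g_i (x) g_i^-1 on the right and X multiplies by the last
    transposition s. The cap d' is left unevaluated: it kills the summand unless g g_i s fixes the
    last point. *)
Lemma T_l_sum n (g : 'S_n.+2) :
  T _ _ (Hl R) n.+1 n.+1 (ph (Down n.+1 1%g) (Up n.+1 g)) =
  \sum_(i < n.+1) @ph [:: up] [:: down] n.+1 n.+1 n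
    (@ph [::] [:: up] n.+1 n n.+1
       (T _ _ Hd' n.+1 n.+1 (ph (Down n.+1 1%g)
          (Up n.+1 (g ∘p emb n.+2 (coset_rep i) ∘p adj n.+2 n))))
       (Up n 1%g))
    (Down n (coset_rep i)^-1%g).
Proof using HT.
have -> : ph (Down n.+1 1%g) (Up n.+1 g) =
    @ph [:: down; up] [::] _ _ _ (ph (Down n.+1 1%g) (Up n.+1 g)) (Id n.+1 1%g).
  rewrite -[RHS](@ph_assoc down [:: up] [::]); congr (ph _ _).
  by rewrite [RHS]ph_1r ract1.
rewrite /Hl !T_comp (@T_ph [:: down; up] [:: down; up] [::] [:: up; down]).
rewrite T_c' ph_sumr !linear_sum; apply: eq_bigr => i _.
rewrite (@T_ph [:: down] [:: down] [:: up] [:: up]) !T_id pcompg1.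
rewrite -(@ph_assoc down [:: up] [:: up; down])
  (@ph_assoc up [:: up] [:: down]).
rewrite (@ph_assoc down [:: up; up] [:: down]).
rewrite (@T_ph [:: down; up; up] [:: down; up; up] [:: down] [:: down]).
rewrite (@T_ph [:: down] [:: down] [:: up; up] [:: up; up]) !T_id T_X.
rewrite (@ph_assoc down [:: up] [:: up]).
rewrite (@T_ph [:: down; up; up] [:: up] [:: down] [:: down]).
by rewrite (@T_ph [:: down; up] [::] [:: up] [:: up]) !T_id.
Qed.

Lemma UpDown00 a (v : Th (up :: a) 0 0) : v = 0.
Proof using HT.
elim/(@ph_ind [:: up] a): v => [//|u v -> ->|k u v]; first exact: addr0.
by rewrite (Up0 u) // ph0l.
Qed.

(** Since s moves the last point and g_i fixes it, g_i s moves the last point for every i. *)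
Lemma T_l_1 n : T _ _ (Hl R) n n (ph (Down n 1%g) (Up n 1%g)) = 0.
Proof using HT.
case: n => [|n]; first exact: UpDown00.
rewrite T_l_sum big1 // => i _; rewrite T_d'_out ?ph0l //.
by rewrite perm1 !pcompE perm1 last_adj_max emb_widen widen_neq_max.
Qed.

(** The product s g_i s fixes the last point only if g_i fixes the second to last one, that is for i
    = [ord_max], where g_i = 1. *)
Lemma T_l_adj n :
  T _ _ (Hl R) n.+1 n.+1 (ph (Down n.+1 1%g) (Up n.+1 (adj n.+2 n))) =
  ph (Up n 1%g) (Down n 1%g).
Proof using HT.
rewrite T_l_sum (bigD1 ord_max) //= [X in _ + X]big1 ?addr0 => [|i ne_i].
  rewrite coset_rep_max (@T_d'_in _ _ _ 1%g); last first.
    by rewrite !emb1 // pcompg1 pcomp1g last_adjK.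
  by rewrite [X in ph X]ph_1l lact1 invg1.
rewrite T_d'_out ?ph0l // perm1 !pcompE last_adj_max emb_widen coset_repE.
rewrite -(inj_eq (@perm_inj _ (adj n.+2 n))) -pcompE last_adjK perm1
  last_adj_max.
by rewrite -val_eqE.
Qed.

Lemma T_r n :
  T _ _ (Hr R) n.+1 n.+1 (ph (Up n 1%g) (Down n 1%g)) =
  ph (Down n.+1 1%g) (Up n.+1 (adj n.+2 n)).
Proof using HT.
have -> : Up n 1%g = @ph [::] [:: up] _ _ _ (Id n.+1 1%g) (Up n 1%g).
  by rewrite [RHS]ph_1l lact1.
rewrite /Hr !T_comp (@T_ph [:: up] [:: down; up; up] [:: down] [:: down]).
rewrite (@T_ph [::] [:: down; up] [:: up] [:: up]) !T_id T_c.
rewrite -(@ph_assoc down [:: up] [:: up]).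
rewrite (@T_ph [:: down; up; up] [:: down; up; up] [:: down] [:: down]).
rewrite (@T_ph [:: down] [:: down] [:: up; up] [:: up; up]) !T_id T_X.
rewrite -(@ph_assoc down [:: up; up] [:: down])
  -(@ph_assoc up [:: up] [:: down]).
rewrite (@ph_assoc down [:: up] [:: up; down]).
rewrite (@T_ph [:: down; up] [:: down; up] [:: up; down] [::]).
rewrite (@T_ph [:: down] [:: down] [:: up] [:: up]) !T_id T_d.
rewrite -(@ph_assoc down [:: up] [::]) [X in ph _ X]ph_1r pcompg1 ract1.
by rewrite emb1 // !pcomp1g.
Qed.

(** This follows from [T_l_adj] because l is a bimodule map; the other double coset, S_(n+1) itself,
    is killed by [T_l_1]. *)
Lemma T_l_double_coset n (x y : 'S_n.+1) :
  T _ _ (Hl R) n.+1 n.+1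
    (ph (Down n.+1 1%g) (Up n.+1 (emb n.+2 x ∘p adj n.+2 n ∘p emb n.+2 y))) =
  ph (Up n x) (Down n y).
Proof using HT.
have -> : ph (Down n.+1 1%g)
             (Up n.+1 (emb n.+2 x ∘p adj n.+2 n ∘p emb n.+2 y)) =
    lact _ x (ract _ y (ph (Down n.+1 1%g) (Up n.+1 (adj n.+2 n)))).
  rewrite (@ract_ph [:: down] [:: up]) (@lact_ph [:: down] [:: up])
    [ract _ y _]ract_vUp [lact _ x _]lact_vDown pcompg1.
  by rewrite -[emb _ x]pcomp1g -ract_vDown ph_bal lact_vUp pcomp1g pcompA.
rewrite bfun_lact bfun_ract T_l_adj (@ract_ph [:: up] [:: down])
  (@lact_ph [:: up] [:: down]).
by rewrite [ract _ y _]ract_vDown [lact _ x _]lact_vUp pcomp1g pcompg1.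
Qed.

(** Y is the rotation of X, hence multiplies by the last transposition on the left. Among the terms
    g_i (x) g_i^-1 inserted by c', l kills the one with g_i = 1, and d' kills all others but one. *)
Lemma T_Y n :
  T _ _ (HY R) n n.+2 (ph (Down n 1%g) (Down n.+1 1%g)) =
  ph (Down n 1%g) (Down n.+1 (adj n.+2 n)).
Proof using HT.
have -> : ph (Down n 1%g) (Down n.+1 1%g) =
    @ph [:: down; down] [::] _ _ _ (ph (Down n 1%g) (Down n.+1 1%g))
      (Id n.+2 1%g).
  rewrite -(@ph_assoc down [:: down] [::]); congr (ph _ _).
  by rewrite [RHS]ph_1r ract1.
rewrite /HY !T_comp (@T_ph [:: down; down] [:: down; down] [::] [:: up; down]).
rewrite (@T_ph [:: down] [:: down] [:: down] [:: down]) !T_id T_c' ph_sumr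
  !linear_sum.
(* The surviving index is the second to last point. *)
pose i0 : 'I_n.+2 := widen_ord (leqnSn n.+1) ord_max.
have termE i :
    T _ _ (Hd' ** 1↓ ** 1↓)%H n n.+2 (T _ _ (1↓ ** Hl R ** 1↓)%H n n.+2
      (@ph [:: down; down] [:: up; down] _ _ _ (ph (Down n 1%g) (Down n.+1 1%g))
        (ph (Up n.+1 (coset_rep i)) (Down n.+1 ((coset_rep i)^-1%g ∘p 1%g))))) =
    if i == i0 then ph (Down n 1%g) (Down n.+1 (adj n.+2 n)) else 0.
  rewrite -(@ph_assoc down [:: down] [:: up; down]).
  rewrite (@ph_assoc down [:: up] [:: down])
    (@ph_assoc down [:: down; up] [:: down]).
  rewrite (@T_ph [:: down; down; up] [:: down; up; down] [:: down] [:: down]).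
  rewrite (@T_ph [:: down] [:: down] [:: down; up] [:: up; down]) !T_id.
  have [->|] := eqVneq i ord_max.
    rewrite coset_rep_max T_l_1 ph0r ph0l linear0.
    by rewrite eq_sym (negbTE (widen_neq_max _)).
  move=> ne_max; have lt_i : (i < n.+1)%N.
    by rewrite ltn_neqAle -ltnS ltn_ord andbT; apply: contraNneq ne_max => ?;
      apply/eqP/val_inj.
  have {ne_max} [j ->] : exists j : 'I_n.+1, i = widen_ord (leqnSn n.+1) j.
    by exists (Ordinal lt_i); apply: val_inj.
  set gi := coset_rep _; set gj := emb n.+2 (coset_rep j).
  (* Both g_i and g_j s send the last point to i, so they differ on the right by an element of
     S_(n+1). *)
  have [x xE] : exists x : 'S_n.+1, gi = gj ∘p adj n.+2 n ∘p emb n.+2 x.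
    have /fix_max_emb[x xE] : ((gj ∘p adj n.+2 n)^-1%g ∘p gi) ord_max = ord_max.
      rewrite pcompE coset_repE -(coset_repE j) -emb_widen.
      by rewrite -last_adj_max -!pcompE -pcompA pcompVg perm1.
    by exists x; rewrite -xE pcompKV.
  rewrite xE T_l_double_coset (@ph_assoc down [:: up] [:: down]).
  rewrite (@T_ph [:: down; up; down] [:: down] [:: down] [:: down]).
  rewrite (@T_ph [:: down; up] [::] [:: down] [:: down]) !T_id.
  rewrite -val_eqE /= (val_eqE j ord_max);
    have [jmax|ne_j] := eqVneq j ord_max; last first.
    by rewrite T_d'_out ?ph0l // perm1 coset_repE.
  rewrite -xE jmax coset_rep_max (@T_d'_in _ _ _ 1%g) ?emb1 ?pcomp1g //.
  rewrite [X in ph X]ph_1l lact1 -[x]pcomp1g -ract_vDown ph_bal lact_vDown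
    pcompg1.
  rewrite xE /gj jmax coset_rep_max emb1 // pcomp1g pcompV pcompA pcompgV
    pcomp1g.
  by rewrite last_adjV.
rewrite (bigD1 i0) //= termE eqxx big1 ?addr0 // => i /negbTE ne_i.
by rewrite [LHS]termE ne_i.
Qed.

(** * The vectors w_i and the actions on them *)

(* g_j (x) g_j^-1 (x) t *)
Definition E a n m (j : 'I_n) (t : Th a n m) : Th (up :: down :: a) n m :=
  @ph [:: up] (down :: a) n m n.-1 (vUp n.-1 (coset_rep j))
    (@ph [:: down] a n.-1 m n (vDown n.-1 (coset_rep j)^-1%g) t).

Section ETheory.
Variables (a : word) (n m : nat).
Implicit Types (j : 'I_n) (t : Th a n m).

Lemma ract_E j g t : ract _ g (E j t) = E j (ract _ g t).
Proof.
by rewrite /E (@ract_ph [:: up] (down :: a)) (@ract_ph [:: down] a).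
Qed.
End ETheory.

(** Normal form of a pair up, down. Write g = g_j s with s fixing the last point: s crosses to the
    second factor, which becomes g_j^-1 g h, and then g h crosses into [t]. *)
Lemma ph_Up_Down a n m (g h : 'S_n.+1) (t : Th a n.+1 m) :
  @ph [:: up] (down :: a) _ _ _ (Up n g) (@ph [:: down] a _ _ _ (Down n h) t) =
  E (g ord_max) (lact _ (g ∘p h) t).
Proof.
set j := g ord_max.
have /fix_max_emb[s sE] : ((coset_rep j)^-1%g ∘p g) ord_max = ord_max.
  by rewrite pcompE -[g _]/j -{2}[j]coset_repE -pcompE pcompVg perm1.
rewrite -{1}(pcompKV (coset_rep j) g) sE -ract_vUp ph_bal.
rewrite (@lact_ph [:: down] a) lact_vDown -sE -pcompA -ract_vDown.
by rewrite ph_bal.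
Qed.

Lemma lact_E a n m (j : 'I_n) g (t : Th a n m) :
  lact _ g (E j t) = E (g j) (lact _ g t).
Proof.
case: n j g t => [[]//|n] j g t.
rewrite /E (@lact_ph [:: up] (down :: a)) lact_vUp ph_Up_Down.
by rewrite pcompE coset_repE -pcompA pcompgV pcompg1.
Qed.

(* g_(i_0) (x) g_(i_0)^-1 g_(i_1) (x) ... (x) g_(i_(k-1))^-1, normalised so  *)
(* that the product of all factors is 1, unlike in [beta_vec].               *)
Fixpoint wvec n k : {ffun 'I_k -> 'I_n} -> Th (ud k) n n :=
  match k with
  | 0 => fun=> Id n 1%g
  | k'.+1 => fun i => E (i ord0) (wvec [ffun p => i (lift ord0 p)])
  end.

(** By [lact_E], g passes through the pairs one at a time and leaves on the right of the unit. *)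
Lemma lact_wvec n k g (i : {ffun 'I_k -> 'I_n}) :
  lact _ g (wvec i) = ract _ g (wvec [ffun p => g (i p)]).
Proof.
elim: k i => [|k IH] i /=;
  first by rewrite [LHS]lact_vId [RHS]ract_vId pcompg1 pcomp1g.
rewrite [LHS]lact_E IH [RHS]ract_E ffunE; congr (E _ (ract _ _ (wvec _))).
by apply/ffunP => p; rewrite !ffunE.
Qed.

(** Needed because [ud a ++ ud b] and [ud (a + b)] are equal but not convertible. *)
Definition tcast a b (e : a = b) n m (v : Th a n m) : Th b n m :=
  ecast z (Th z n m) e v.

Lemma tcast_id a (e : a = a) n m (v : Th a n m) : tcast e v = v.
Proof. by rewrite (Prop_irrelevance e (erefl a)). Qed.

Lemma tcast_ph x a b (e : a = b) (e' : x :: a = x :: b) n m k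
    (u : Th [:: x] n k) (v : Th a k m) :
  tcast e' (@ph [:: x] a _ _ _ u v) = @ph [:: x] b _ _ _ u (tcast e v).
Proof. by case: b / e e' => e'; rewrite tcast_id. Qed.

Lemma wvec_cat n a b (i : {ffun 'I_(a + b) -> 'I_n}) :
  wvec i = tcast (udD a b)
    (ph (wvec [ffun p => i (lshift b p)]) (wvec [ffun p => i (rshift a p)])).
Proof.
elim: a i => [|a IH] i.
  rewrite [ph _ _]ph_1l lact1 tcast_id; congr (wvec _).
  by apply/ffunP => p; rewrite ffunE; congr (i _); apply: val_inj.
rewrite [LHS]/= IH [wvec [ffun p => i (lshift b p)]]/=.
have e1 : down :: ud a ++ ud b = down :: ud (a + b) by rewrite udD.
rewrite /E -(@ph_assoc up (down :: ud a) (ud b)) -(@ph_assoc down (ud a)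
  (ud b)).
rewrite (tcast_ph e1) (tcast_ph (udD a b)) ffunE.
have -> : lshift b (ord0 : 'I_a.+1) = ord0 :> 'I_(a + b).+1 by apply: val_inj.
have -> : [ffun p => [ffun q => i (lift ord0 q)] (lshift b p)] =
          [ffun q => [ffun p => i (lshift b p)] (lift ord0 q)]
    :> {ffun 'I_a -> 'I_n}.
  by apply/ffunP => p; rewrite !ffunE; congr (i _); apply: val_inj.
have -> // : [ffun p => [ffun q => i (lift ord0 q)] (rshift a p)] =
          [ffun p => i (rshift a.+1 p)] :> {ffun 'I_b -> 'I_n}.
by apply/ffunP => p; rewrite !ffunE; congr (i _); apply: val_inj.
Qed.

(** * The five generators on the vectors w_i *)

Lemma E_Id n (j : 'I_n.+1) :
  E j (Id n.+1 1%g) = ph (Up n (coset_rep j)) (Down n (coset_rep j)^-1%g).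
Proof. by rewrite /E /= [X in ph _ X]ph_1r ract1. Qed.

Lemma T_Psi_epsilon n (j : 'I_n) :
  T _ _ (Psi_epsilon R) n n (E j (Id n 1%g)) = Id n 1%g.
Proof. by case: n j => [[]//|n] j; rewrite E_Id T_d pcompgV. Qed.

Lemma T_Psi_eta n :
  T _ _ (Psi_eta R) n n (Id n 1%g) = \sum_(j < n) E j (Id n 1%g).
Proof.
case: n => [|n]; first by rewrite big_ord0; apply: UpDown00.
by rewrite [LHS]T_c'; apply: eq_bigr => j _; rewrite E_Id pcompg1.
Qed.

(** The cup gives g_j (x) 1 (x) 1 (x) g_j^-1, which [ph_Up_Down] brings to normal form. *)
Lemma T_Psi_delta n (j : 'I_n) :
  T _ _ (Psi_delta R) n n (E j (Id n 1%g)) = E j (E j (Id n 1%g)).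
Proof.
case: n j => [[]//|n] j; rewrite E_Id.
have {1}-> : Up n (coset_rep j) =
    @ph [:: up] [::] _ _ _ (Up n (coset_rep j)) (Id n 1%g).
  by rewrite [RHS]ph_1r ract1.
rewrite (@T_ph [:: up] [:: up; down; up] [:: down] [:: down]).
rewrite (@T_ph [:: up] [:: up] [::] [:: down; up]) !T_id T_c.
rewrite -(@ph_assoc up [:: down; up] [:: down])
  -(@ph_assoc down [:: up] [:: down]).
rewrite (@ph_Up_Down [:: up; down]) coset_repE pcompg1; congr (E _ _).
by rewrite (@lact_ph [:: up] [:: down]) lact_vUp pcompg1.
Qed.

(** The cap d' tests whether g_i^-1 g_j lies in S_(n-1), that is, whether i = j. *)
Lemma T_Psi_mu n (i j : 'I_n) :
  T _ _ (Psi_mu R) n n (E i (E j (Id n 1%g))) =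
  if i == j then E i (Id n 1%g) else 0.
Proof.
case: n i j => [[]//|n] i j; rewrite [E j _]E_Id [X in T _ _ _ _ _ X]/E.
rewrite (@ph_assoc down [:: up] [:: down])
  (@ph_assoc up [:: down; up] [:: down]).
rewrite (@T_ph [:: up; down; up] [:: up] [:: down] [:: down]).
rewrite (@T_ph [:: up] [:: up] [:: down; up] [::]) !T_id.
have [->|ne_ij] := eqVneq i j.
  rewrite (@T_d'_in _ _ _ 1%g) ?emb1 ?pcompVg // [X in ph X _]ph_1r ract1.
  by rewrite E_Id.
rewrite T_d'_out ?ph0r ?ph0l // coset_repE.
rewrite -(inj_eq (@perm_inj _ (coset_rep i))) -pcompE pcompgV perm1.
by rewrite coset_repE eq_sym.
Qed.

Lemma T_middle (b c : word) (f : hmor R b c) n m k l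
    (u : Th [:: up] n m) (v : Th b m k) (w : Th [:: down] k l) :
  T _ _ (1↑ ** f ** 1↓)%H n l (@ph (up :: b) [:: down] _ _ _
    (@ph [:: up] b _ _ _ u v) w) =
  @ph (up :: c) [:: down] _ _ _ (@ph [:: up] c _ _ _ u (T _ _ f m k v)) w.
Proof.
by rewrite (@T_ph (up :: b) (up :: c) [:: down] [:: down])
  (@T_ph [:: up] [:: up] b c) !T_id.
Qed.

(** All four factors are 1. The first summand of Psi(s) vanishes because l kills 1 (x) 1, and the
    second, c after d', fixes 1 (x) 1. *)
Lemma T_Psi_s_diag_max n :
  T _ _ (Psi_s R) n.+1 n.+1 (E ord_max (E ord_max (Id n.+1 1%g))) =
  E ord_max (E ord_max (Id n.+1 1%g)).
Proof.
have -> : E ord_max (E ord_max (Id n.+1 1%g)) =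
    @ph [:: up; down; up] [:: down] _ _ _
      (@ph [:: up] [:: down; up] _ _ _ (Up n 1%g) (ph (Down n 1%g) (Up n 1%g)))
      (Down n 1%g).
  rewrite [E _ (Id _ _)]E_Id /E coset_rep_max invg1.
  by rewrite (@ph_assoc down [:: up] [:: down])
    (@ph_assoc up [:: down; up] [:: down]).
rewrite T_add !T_comp (@T_middle [:: down; up] [:: up; down])
  (@T_middle [:: down; up] [:: down; up]) T_l_1 T_comp
  (@T_d'_in _ _ _ 1%g) ?emb1 ?pcomp1g // T_c.
by rewrite ph0r ph0l !linear0 add0r.
Qed.

(** With s the last transposition, the four factors can be taken to be 1, 1, s, s. Now d' kills the
    middle pair, and the first summand of Psi(s) produces s (x) 1 (x) s (x) 1, whose normal form is
    the right-hand side. *)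
Lemma T_Psi_s_max n (i := widen_ord (leqnSn n.+1) ord_max) :
  T _ _ (Psi_s R) n.+2 n.+2 (E ord_max (E i (Id n.+2 1%g))) =
  E i (E ord_max (Id n.+2 1%g)).
Proof.
have -> : E ord_max (E i (Id n.+2 1%g)) =
    @ph [:: up; down; up] [:: down] _ _ _
      (@ph [:: up] [:: down; up] _ _ _ (Up n.+1 1%g)
        (ph (Down n.+1 1%g) (Up n.+1 (adj n.+2 n))))
      (Down n.+1 (adj n.+2 n)).
  rewrite -(@ph_assoc up [:: down; up] [:: down])
    -(@ph_assoc down [:: up] [:: down]).
  have -> : ph (Up n.+1 (adj n.+2 n)) (Down n.+1 (adj n.+2 n)) =
    E i (Id n.+2 1%g).
    have := @ph_Up_Down [::] _ _ (adj n.+2 n) (adj n.+2 n) (Id n.+2 1%g).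
    by rewrite last_adj_max last_adjK lact1 [X in ph _ X = _]ph_1r ract1.
  by rewrite /E coset_rep_max invg1.
rewrite T_add !T_comp (@T_middle [:: down; up] [:: up; down])
  (@T_middle [:: down; up] [:: down; up]) T_l_adj T_comp T_d'_out;
  last first.
  by rewrite perm1 last_adj_max widen_neq_max.
rewrite linear0 ph0r ph0l addr0.
rewrite -(@ph_assoc up [:: up; down] [:: down])
  -(@ph_assoc up [:: down] [:: down]).
rewrite (@ph_assoc up [:: up] [:: down; down]).
rewrite (@T_ph [:: up; up] [:: up; up] [:: down; down] [:: down; down]) T_X.
have -> : ph (Down n 1%g) (Down n.+1 (adj n.+2 n)) =
    ract _ (adj n.+2 n) (ph (Down n 1%g) (Down n.+1 1%g)).
  by rewrite (@ract_ph [:: down] [:: down]) ract_vDown pcomp1g.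
rewrite bfun_ract T_Y (@ract_ph [:: down] [:: down]) ract_vDown last_adjK.
rewrite emb1 // !pcomp1g -(@ph_assoc up [:: up] [:: down; down]).
rewrite (@ph_assoc up [:: down] [:: down])
  (@ph_assoc up [:: up; down] [:: down]).
rewrite (@T_middle [:: up; down] [:: down; up]) T_r.
rewrite -(@ph_assoc up [:: down; up] [:: down])
  -(@ph_assoc down [:: up] [:: down]).
rewrite (@ph_Up_Down [:: up; down]) last_adj_max pcompg1; congr (E _ _).
by rewrite (@lact_ph [:: up] [:: down]) lact_vUp last_adjK E_Id coset_rep_max
  invg1.
Qed.

(* By equivariance only one pair i <> j has to be computed.                  *)
Lemma T_Psi_s n (i j : 'I_n) :
  T _ _ (Psi_s R) n n (E i (E j (Id n 1%g))) = E j (E i (Id n 1%g)).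
Proof.
(* The right factor g^-1 cancels the g that [lact_E] pushes out on the right. *)
have move_to (g : 'S_n) (x y : 'I_n) :
    E (g x) (E (g y) (Id n 1%g)) =
      ract _ g^-1%g (lact _ g (E x (E y (Id n 1%g)))).
  rewrite !lact_E !ract_E; congr (E _ (E _ _)).
  rewrite [lact _ _ _]lact_vId [ract _ _ _]ract_vId pcompg1.
  by rewrite pcompgV.
case: n i j move_to => [[]//|n] i j move_to.
have [->|ne_ij] := eqVneq i j.
  rewrite -(coset_repE j) move_to bfun_ract bfun_lact.
  by rewrite [T _ _ _ _ _ _]T_Psi_s_diag_max.
case: n i j ne_ij move_to => [|n] i j ne_ij move_to.
  by rewrite !ord1 eqxx in ne_ij.
pose m : 'I_n.+2 := widen_ord (leqnSn n.+1) ord_max.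
have [g [<- <-]] : exists g : 'S_n.+2, g ord_max = i /\ g m = j.
  (* The representative g_i sends the last point to i; the transposition corrects the image of m and
     fixes the last point, because i <> j. *)
  pose h := coset_rep i; exists (h ∘p tperm m (h^-1%g j)); rewrite !pcompE.
  split; last by rewrite tpermL -pcompE pcompgV perm1.
  rewrite tpermD ?coset_repE // ?widen_neq_max //.
  apply: contraNneq ne_ij => e.
  by rewrite -(coset_repE i) -/h -[ord_max]e -pcompE pcompgV perm1.
rewrite !move_to bfun_ract bfun_lact; congr (ract _ _ (lact _ _ _)).
exact: T_Psi_s_max.
Qed.

(** * Comparison with beta, spanning and independence of the w_i *)

(** The two tensors differ by a right factor that normalises the product. The trivial module will
    absorb it, so its value is left unspecified. *)
Lemma beta_vecE n k (h : 'S_n) (i : {ffun 'I_k -> 'I_n}) :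
  exists x, beta_vec R h i = ract _ x (lact _ h^-1%g (wvec i)).
Proof.
elim: k h i => [|k IH] h i.
  by exists h; rewrite [lact _ _ _]lact_vId [RHS]ract_vId pcompg1 pcompVg.
case: n IH h i => [|n] IH h i; first by case: (i ord0).
rewrite [beta_vec _ _ _]/= [wvec _]/=; set g := coset_rep (i ord0);
  set i' := finfun _.
have [x xE] := IH g i'; exists x.
have -> : ud_cons (h^-1%g ∘p g) (beta_vec R g i') =
    @ph [:: up] (down :: ud k) _ _ _ (Up n (h^-1%g ∘p g))
      (@ph [:: down] (ud k) _ _ _ (Down n 1%g) (beta_vec R g i')).
  case: k {IH} i i' @g {x xE} => [|k] i i' g; last by rewrite !ph_fpure.
  by rewrite [X in ph _ X]ph_1r ract1 [RHS]ph_fpure.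
rewrite ph_Up_Down pcompg1 xE pcompE coset_repE.
rewrite [X in _ = ract _ _ X]lact_E [RHS]ract_E; congr (E _ _).
by rewrite lract -lactM -pcompA pcompgV pcompg1.
Qed.

(** On pure tensors, [ph_Up_Down] turns the first pair into an [E], and [lact_wvec] carries the
    remaining permutation through the tail and out to the right. *)
Lemma wvec_span n k (P : Th (ud k) n n -> Prop) :
  P 0 -> (forall u v, P u -> P v -> P (u + v)) ->
  (forall x u, P u -> P (x *: u)) ->
  (forall i g, P (ract _ g (wvec i))) -> forall v, P v.
Proof.
elim: k P => [|k IH] P P0 PD PZ P1.
  apply: perm_mod_ind => // _ g.
  rewrite -[g]pcomp1g -[pvec _ _ _]ract_vId.
  exact: (P1 (ffun0 (card_ord 0)) g).
apply: (@ph_ind [:: up] (down :: ud k)) => // k1 u.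
apply: (@ph_ind [:: down] (ud k)).
- by rewrite ph0r.
- by move=> x y Px Py; rewrite phDr; apply: PD.
move=> k2 v t.
have [nk1|ne] := eqVneq n k1.+1; last by rewrite (Up0 u) // ph0l.
have [k21|ne] := eqVneq k2 k1.+1; last by rewrite (Down0 v) // ph0l ph0r.
subst n k2; move: t; apply: IH => [|t t'|x t|i g].
- by rewrite !ph0r.
- by rewrite !phDr; apply: PD.
- by rewrite !phZr; apply: PZ.
move: u; apply: perm_mod_ind => [|u u'|x u|_ g'].
- by rewrite ph0l.
- by rewrite phDl; apply: PD.
- by rewrite phZl; apply: PZ.
move: v; apply: perm_mod_ind => [|v v'|x v|_ h].
- by rewrite ph0l ph0r.
- by rewrite phDl phDr; apply: PD.
- by rewrite phZl phZr; apply: PZ.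
rewrite [X in P X]ph_Up_Down lract lact_wvec -ractM -ract_E.
suff -> : E (g' ord_max) (wvec [ffun p => (g' ∘p h) (i p)]) =
    wvec [ffun p =>
      if unlift ord0 p is Some q then (g' ∘p h) (i q) else g' ord_max] by [].
rewrite [RHS]/= ffunE unlift_none; congr (E _ (wvec _)).
by apply/ffunP => p; rewrite !ffunE liftK.
Qed.

Lemma ffun_ordS_eq (S : eqType) k (i j : {ffun 'I_k.+1 -> S}) :
  (i == j) = (i ord0 == j ord0) &&
    ([ffun p => i (lift ord0 p)] == [ffun p => j (lift ord0 p)]).
Proof.
apply/eqP/andP => [-> //|[/eqP e0 /eqP/ffunP e]]; apply/ffunP => p.
by case: (unliftP ord0 p) => [q ->|-> //]; have := e q; rewrite !ffunE.
Qed.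

(* A left inverse of [E j] that kills the image of [E i] for [i != j].       *)
Definition uncons n m k (j : 'I_n.+1) (v : Th (ud k.+1) n.+1 m) :
  Th (ud k) n.+1 m :=
  T _ _ (Hd ** Hid (ud k))%H n.+1 m
    (@ph [:: up] (down :: ud k) _ _ _ (Up n (coset_rep j))
      (T _ _ (Hd' ** Hid (down :: ud k))%H n m
        (@ph [:: down] (ud k.+1) _ _ _ (Down n (coset_rep j)^-1%g) v))).

Lemma uncons_linear n m k j : linear (@uncons n m k j).
Proof.
pose cap_down := @phr [:: down] (ud k.+1) n m n.+1 (Down n (coset_rep j)^-1%g).
pose cap_up := @phr [:: up] (down :: ud k) n.+1 m n (Up n (coset_rep j)).
move=> x u v; rewrite /uncons -[ph _ (_ + _)]/(cap_down (x *: u + v)).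
rewrite (linearP cap_down) (linearP (T _ _ (Hd' ** Hid (down :: ud k))%H n m)).
set y := T _ _ _ _ _ (cap_down u); set z := T _ _ _ _ _ (cap_down v).
rewrite -[ph _ (_ + _)]/(cap_up (x *: y + z)) (linearP cap_up).
exact: (linearP (T _ _ (Hd ** Hid (ud k))%H n.+1 m)).
Qed.

Lemma uncons_ract n m k j g v :
  @uncons n m k j (ract _ g v) = ract _ g (uncons j v).
Proof.
rewrite /uncons -(@ract_ph [:: down] (ud k.+1)) bfun_ract.
by rewrite -(@ract_ph [:: up] (down :: ud k)) bfun_ract.
Qed.

Lemma uncons_E n m k (i j : 'I_n.+1) (t : Th (ud k) n.+1 m) :
  uncons j (E i t) = if i == j then t else 0.
Proof.
rewrite /uncons /E (@ph_assoc down [:: up] (down :: ud k)).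
rewrite (@T_ph [:: down; up] [::] (down :: ud k) (down :: ud k)) T_id.
have [->|ne_ij] := eqVneq i j.
  rewrite (@T_d'_in _ _ _ 1%g) ?emb1 ?pcompVg // [X in ph _ X]ph_1l lact1.
  rewrite (@ph_assoc up [:: down] (ud k)).
  rewrite (@T_ph [:: up; down] [::] (ud k) (ud k)) T_id T_d pcompgV.
  by rewrite [LHS]ph_1l lact1.
rewrite T_d'_out ?ph0l ?ph0r ?linear0 // coset_repE.
by rewrite -(inj_eq (@perm_inj _ (coset_rep j))) -pcompE pcompgV perm1
  coset_repE.
Qed.

(** [uncons] strips the pairs with the expected indices one by one, and the augmentation evaluates
    what is left. Invariance on the right lets the functional descend to the tensor product with the
    trivial module. *)
Lemma wvec_coef n k (j : {ffun 'I_k -> 'I_n}) :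
  exists f : Th (ud k) n n -> R^o, [/\ linear f,
    forall s u, f (ract _ s u) = f u & forall i, f (wvec i) = (i == j)%:R].
Proof.
elim: k j => [|k IH] j.
  exists (@coef_sum R n (n == n)); split; first exact: coef_sum_linear.
    pose f : {linear perm_mod R n (n == n) -> R^o} :=
      HB.pack (@coef_sum R n (n == n)) (GRing.isLinear.Build _ _ _ _ _
        (@coef_sum_linear R n (n == n))).
    move=> s; apply: perm_mod_ind => [|u v fu fv|x u fu|_ g].
    - by rewrite linear0.
    - by rewrite linearD [LHS](linearD f) [RHS](linearD f) /= fu fv.
    - by rewrite linearZ_LR [LHS](linearZ_LR f) [RHS](linearZ_LR f) /= fu.
    by rewrite [ract _ _ _]ract_vId !coef_sum_pvec ?eqxx.
  move=> i; rewrite [LHS]coef_sum_pvec ?eqxx //.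
  have -> : i = j by apply/ffunP => -[].
  by rewrite eqxx.
case: n IH j => [|n] IH j; first by case: (j ord0).
have [f [fl fr fw]] := IH [ffun p => j (lift ord0 p)].
exists (fun v => f (uncons (j ord0) v)); split.
- by move=> x u v; rewrite uncons_linear fl.
- by move=> s u; rewrite uncons_ract fr.
move=> i; rewrite [wvec i]/= uncons_E ffun_ordS_eq.
case: eqP => _ /=; first exact: fw.
(* This is f 0 = 0, extracted from the linearity identity [fl]. *)
by rewrite -{1}(addNr 0) -scaleN1r fl scaleN1r addNr.
Qed.

(** * Descent to the quotient by the bubble relation *)

(** Each pair up, down leads from n to n - 1 and back to n. *)
Lemma ud_offdiag a n m (v : Th (ud a) n m) : n != m -> v = 0.
Proof.
elim: a v => [|a IH] v ne_nm; first exact: Th_nil0.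
elim/(@ph_ind [:: up] (down :: ud a)): v => [//|u v -> ->|k1 u v];
  first exact: addr0.
have [nk1|ne] := eqVneq n k1.+1; last by rewrite (Up0 u) // ph0l.
elim/(@ph_ind [:: down] (ud a)): v => [|v w hv hw|k2 v t];
  first by rewrite ph0r.
  by rewrite phDr hv hw addr0.
have [k21|ne] := eqVneq k2 k1.+1; last by rewrite (Down0 v) // ph0l ph0r.
by subst n k2; rewrite (IH t) // !ph0r.
Qed.

Lemma T_hcast a a' b b' (ea : a = a') (eb : b = b') (f : hmor R a b) n m v :
  T _ _ (hcast ea eb f) n m (tcast ea v) = tcast eb (T _ _ f n m v).
Proof. by case: a' / ea; case: b' / eb. Qed.

(** Each of the n summands g_i g_i^-1 g equals g. For n = 0 the map factors through a zero
    bimodule. *)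
Lemma T_bubble n (v : Th [::] n n) : T _ _ (Hd ∘ Hc')%H n n v = n%:R *: v.
Proof.
rewrite T_comp; case: n v => [|n] v;
  first by rewrite scale0r [X in T _ _ _ _ _ X]UpDown00 linear0.
move: v; apply: perm_mod_ind => [|u v hu hv|x u hu|_ g].
- by rewrite !linear0.
- by rewrite !linearD hu hv.
- rewrite (linearZ_LR (T _ _ Hc' n.+1 n.+1)) (linearZ_LR (T _ _ Hd n.+1 n.+1))
  hu.
  by rewrite !scalerA mulrC.
rewrite T_c' linear_sum -[LHS]/(\sum_(i < n.+1) _).
under eq_bigr => i _ do rewrite T_d pcompKV.
by rewrite sumr_const card_ord scaler_nat.
Qed.

(* Off-diagonal components of the objects (up down)^k vanish, so the bubble  *)
(* relation, which only holds on (n, n), survives tensoring.                 *)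
Lemma T_Hudeq n a b (f g : hmor R (ud a) (ud b)) :
  Hudeq n%:R f g -> forall v, T _ _ f n n v = T _ _ g n n v.
Proof.
elim=> {a b f g} [a b f g fg v||a b f g _ h v|a b f g h _ fg _ gh v|
  a b c f f' g g' _ ff' _ gg' v|a b a' b' f f' g g' _ ff' _ gg' v|
  a b f f' g g' _ ff' _ gg' v|a b x f f' _ ff' v].
- exact: (fmap_eq T fg).
- by move=> v; rewrite T_bubble T_scale T_id.
- by rewrite h.
- by rewrite fg gh.
- by rewrite !T_comp ff' gg'.
- rewrite /ud_tens.
  have [w ->] : exists w, v = tcast (udD a a') w.
    by case: _ / (udD a a') v => v; exists v.
  rewrite !T_hcast; congr tcast; move: w.
  apply: ph_ind => [|u w hu hw|k u w]; first by rewrite !linear0.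
    by rewrite !linearD hu hw.
  rewrite !T_ph; have [nk|ne] := eqVneq n k;
    last by rewrite (ud_offdiag u) // !linear0 !ph0l.
  by subst k; rewrite ff' gg'.
- by rewrite !T_add ff' gg'.
- by rewrite !T_scale ff'.
Qed.

Section Wmap.
Variables n k : nat.

Definition wcomb (v : Vpow R n k) : Th (ud k) n n :=
  \sum_i (v : vpow_mod R n k) i *: wvec i.

Lemma wcomb_linear : linear wcomb.
Proof.
move=> x u v; rewrite /wcomb scaler_sumr -big_split; apply: eq_bigr => i _.
by rewrite !ffunE scalerDl scalerA.
Qed.

(** The lift of beta to bimodules. It commutes with the left action only up to a right factor, by
    [lact_wvec]. *)
Definition wmap : {linear Vpow R n k -> Th (ud k) n n} :=
  HB.pack wcomb (GRing.isLinear.Build _ _ _ _ _ wcomb_linear).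

Lemma wmap_tbasis i : wmap (tbasis R i) = wvec i.
Proof.
rewrite /wmap /= /wcomb (bigD1 i) //= big1 => [|j /negbTE ne_ji].
  by rewrite ffunE eqxx scale1r addr0.
by rewrite ffunE ne_ji scale0r.
Qed.

Lemma tbasis_sum (v : Vpow R n k) :
  v = \sum_i (v : vpow_mod R n k) i *: tbasis R i.
Proof.
apply/ffunP => j; rewrite sum_ffunE (bigD1 j) //= big1 => [|i /negbTE ne_ij].
  by rewrite !ffunE eqxx addr0 [RHS]mulr1.
by rewrite !ffunE eq_sym ne_ij [LHS]mulr0.
Qed.
End Wmap.

Lemma ffun_add_eq (S : eqType) a b (i j : {ffun 'I_(a + b) -> S}) :
  (i == j) =
    ([ffun p => i (lshift b p)] == [ffun p => j (lshift b p)]) &&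
    ([ffun p => i (rshift a p)] == [ffun p => j (rshift a p)]).
Proof.
apply/eqP/andP => [-> //|[/eqP/ffunP el /eqP/ffunP er]]; apply/ffunP => p.
by case: (split_ordP p) => q ->; [have := el q|have := er q]; rewrite !ffunE.
Qed.

Lemma tbasis_vtens n a b (i : {ffun 'I_(a + b) -> 'I_n}) :
  tbasis R i = vtens (tbasis R [ffun p => i (lshift b p)])
                     (tbasis R [ffun p => i (rshift a p)]).
Proof.
apply/ffunP => j; rewrite !ffunE ffun_add_eq.
by case: (_ == _) => /=; rewrite ?mul1r ?mul0r.
Qed.

Lemma wmap_vtens n a b (u : Vpow R n a) (v : Vpow R n b) :
  wmap n (a + b) (vtens u v) = tcast (udD a b) (ph (wmap n a u) (wmap n b v)).
Proof.
pose cat_ffun (i : {ffun 'I_a -> 'I_n} * {ffun 'I_b -> 'I_n}) :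
  {ffun 'I_(a + b) -> 'I_n} :=
  [ffun p => match split p with inl q => i.1 q | inr q => i.2 q end].
have catl i : [ffun p => cat_ffun i (lshift b p)] = i.1.
  by apply/ffunP => p; rewrite !ffunE (unsplitK (inl p)).
have catr i : [ffun p => cat_ffun i (rshift a p)] = i.2.
  by apply/ffunP => p; rewrite !ffunE (unsplitK (inr p)).
have cat_bij : bijective cat_ffun.
  exists (fun i : {ffun 'I_(a + b) -> 'I_n} =>
    ([ffun p => i (lshift b p)], [ffun p => i (rshift a p)])).
    by move=> i; rewrite catl catr; case: i.
  by move=> i; apply/eqP; rewrite ffun_add_eq catl catr !eqxx.
have tcastD : {morph @tcast _ _ (udD a b) n n : x y / x + y}.
  by case: _ / (udD a b).
have tcast0 : tcast (udD a b) (0 : Th (ud a ++ ud b) n n) = 0.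
  by case: _ / (udD a b).
have tcastZ x y : tcast (udD a b) (x *: y : Th (ud a ++ ud b) n n) =
  x *: tcast (udD a b) y.
  by case: _ / (udD a b) y.
rewrite -[LHS]/(wcomb _) /wcomb (reindex cat_ffun) /=; last exact: onW_bij.
rewrite ph_suml (big_morph _ tcastD tcast0).
under [RHS]eq_bigr => i _ do rewrite ph_sumr (big_morph _ tcastD tcast0).
rewrite pair_big; apply: eq_bigr => i _ /=.
by rewrite ffunE wvec_cat catl catr phZl phZr !tcastZ scalerA.
Qed.

End ThetaTheory.

(** * Naturality *)

Section StensLift.
Variables (R : comPzRingType) (n : nat) (M : bimod R n n) (f : M -> R^o).
Hypothesis f_lin : linear f.
Hypothesis f_ract : forall s u, f (ract M s u) = f u.

Definition stens_lift : {linear stens M (triv R n) -> R^o}.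
Proof.
refine (@tensor_lift R unit (fun=> n) (fun=> M) (fun=> triv R n) R^o
  (fun _ s => ract M s) (fun _ s => sact (triv R n) s)
  (fun _ u x => (x : R^o) * f u) _ _ _).
- by move=> _ x a u v; rewrite f_lin mulrDr; congr (_ + _); apply: mulrCA.
- by move=> _ u a x y; rewrite mulrDl; congr (_ + _); rewrite -[LHS]mulrA.
- by move=> _ s u x; rewrite f_ract.
Defined.

Lemma stens_liftE (u : M) (x : triv R n) :
  stens_lift (spure u x) = (x : R^o) * f u.
Proof. exact: tensor_liftE. Qed.
End StensLift.

Section Naturality.
Variables (R : comPzRingType) (n : nat).
Variable Psi : @linfunctor R (Par n%:R) (Heis_ud n%:R) (fun k => k).
Hypothesis HPsi : is_Psi Psi.
Variable Theta : @linfunctor R (Heis R) (BiFam R) (@Theta_ob R).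
Variable phi : forall a b, fhom (ftens (@Theta_ob R a) (@Theta_ob R b))
                                (@Theta_ob R (a ++ b)).
Hypothesis HTheta : is_Theta Theta phi.
Variable Phi : @linfunctor R (Par n%:R) (SMod R n) (@Vpow R n).
Hypothesis HPhi : is_Phi Phi.

Notation Th := (@Theta_ob R).
Notation Id := (vId n 1%g : Th [::] n n).
Notation wvec := (wvec phi).
Notation wmap := (wmap phi).

Definition intertwined a b (f : par_hom R a b) : Prop :=
  forall v, Theta _ _ (Psi a b f) n n (wmap n a v) = wmap n b (Phi a b f v).

Lemma intertwined_tbasis a b (f : par_hom R a b) :
  (forall i, Theta _ _ (Psi a b f) n n (wvec i) =
             wmap n b (Phi a b f (tbasis R i))) -> intertwined f.
Proof.
move=> h v; have [c ->] : exists c : {ffun 'I_a -> 'I_n} -> R,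
    v = \sum_i c i *: tbasis R i.
  by exists (v : vpow_mod R n a); apply: tbasis_sum.
rewrite (linear_sum (wmap n a)) (linear_sum (Theta _ _ (Psi a b f) n n)).
rewrite (linear_sum (Phi a b f)) (linear_sum (wmap n b)).
by apply: eq_bigr => i _; rewrite !linearZ_LR wmap_tbasis h.
Qed.

Lemma T_Psi_Hudeq a b (f : par_hom R a b) (g : hmor R (ud a) (ud b)) :
  Hudeq n%:R (Psi a b f) g -> forall v,
  Theta _ _ (Psi a b f) n n v = Theta _ _ g n n v.
Proof. exact: (T_Hudeq HTheta). Qed.

Lemma intertwined_id m : intertwined (pbasis R (id_diagram m)).
Proof.
move=> v; rewrite (T_Psi_Hudeq (fmap_id Psi m)) T_id; congr (wmap n m _).
by symmetry; apply: (fmap_id Phi m).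
Qed.

Lemma intertwined_comp a b c (f : par_hom R b c) (g : par_hom R a b) :
  intertwined f -> intertwined g -> intertwined (par_comp n%:R f g).
Proof.
move=> hf hg v; rewrite (T_Psi_Hudeq (fmap_comp Psi f g)) T_comp hg hf.
by congr (wmap n c _); symmetry; apply: (fmap_comp Phi f g).
Qed.

Lemma intertwined_sum a b I (r : seq I) (c : I -> R) (f : I -> par_hom R a b) :
  (forall i, intertwined (f i)) -> intertwined (\sum_(i <- r) c i *: f i).
Proof.
move=> hf;
have hD (g h : par_hom R a b) :
    intertwined g -> intertwined h -> intertwined (g + h).
  move=> hg hh v; rewrite (T_Psi_Hudeq (fmap_add Psi g h)) T_add hg hh -linearD.
  by congr (wmap n b _); symmetry; apply: (fmap_add Phi g h).
have hZ x (g : par_hom R a b) : intertwined g -> intertwined (x *: g).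
  move=> hg v; rewrite (T_Psi_Hudeq (fmap_scale Psi x g)) T_scale hg
    -linearZ_LR.
  by congr (wmap n b _); symmetry; apply: (fmap_scale Phi x g).
elim: r => [|i r IH]; last by rewrite big_cons; apply/hD/IH/hZ.
(* A [linfunctor] records sums and scalings only, so the zero morphism is treated as 0 times
   itself. *)
rewrite big_nil -(scale0r (0 : par_hom R a b)) => v.
rewrite (T_Psi_Hudeq (fmap_scale Psi _ _)) T_scale [LHS]scale0r.
transitivity (wmap n b 0); first by rewrite linear0.
congr (wmap n b _); rewrite -(scale0r (Phi a b 0 v)).
by symmetry; apply: (fmap_scale Phi 0 0).
Qed.

(** All three functors involved are monoidal and [wmap] is multiplicative; this is the step that
    forces the passage to bimodules. *)
Lemma intertwined_tens a b a' b' (f : par_hom R a b) (g : par_hom R a' b') :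
  intertwined f -> intertwined g -> intertwined (par_tens f g).
Proof.
move=> hf hg; apply: intertwined_tbasis => i.
rewrite (T_Psi_Hudeq (Psi_tens HPsi f g)) -(wmap_tbasis phi) tbasis_vtens.
rewrite (Phi_tens HPhi) !(wmap_vtens HTheta) /ud_tens T_hcast.
by rewrite (T_ph HTheta) hf hg.
Qed.

Lemma intertwined_generators :
  [/\ intertwined (@par_mu R), intertwined (@par_delta R),
      intertwined (@par_eta R), intertwined (@par_epsilon R) &
      intertwined (@par_s R)].
Proof.
have wvec0 (i : {ffun 'I_0 -> 'I_n}) : wvec i = Id by [].
have wvec1 (i : {ffun 'I_1 -> 'I_n}) : wvec i = E phi (i ord0) Id by [].
have wvec2 (i : {ffun 'I_2 -> 'I_n}) :
    wvec i = E phi (i ord0) (E phi (i ord_max) Id).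
  have lift0 : lift ord0 ord0 = ord_max :> 'I_2 by apply: val_inj.
  by rewrite -lift0 -[i (lift _ _)](ffunE (fun p => i (lift ord0 p))).
split; apply: intertwined_tbasis => i.
- rewrite (T_Psi_Hudeq (Psi_muE HPsi)) (Phi_mu HPhi) wvec2 (T_Psi_mu HTheta).
  by case: eqP => _; rewrite ?linear0 // wmap_tbasis wvec1 ffunE.
- rewrite (T_Psi_Hudeq (Psi_deltaE HPsi)) (Phi_delta HPhi) wvec1.
  by rewrite (T_Psi_delta HTheta) wmap_tbasis wvec2 !ffunE.
- rewrite (T_Psi_Hudeq (Psi_etaE HPsi)) (Phi_eta HPhi) (T_Psi_eta HTheta).
  by rewrite linear_sum; apply: eq_bigr => j _; rewrite wmap_tbasis wvec1 ffunE.
- rewrite (T_Psi_Hudeq (Psi_epsilonE HPsi)) (Phi_epsilon HPhi) wvec1.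
  by rewrite (T_Psi_epsilon HTheta) wmap_tbasis.
rewrite (T_Psi_Hudeq (Psi_sE HPsi)) (Phi_s HPhi) wvec2 (T_Psi_s HTheta).
have rev0 : rev_ord ord0 = ord_max :> 'I_2 by apply: val_inj.
have rev1 : rev_ord ord_max = ord0 :> 'I_2 by apply: val_inj.
by rewrite wmap_tbasis wvec2 !ffunE rev0 rev1.
Qed.

Lemma par_comp_pbasis (t : R) m l k (D : diagram l k) (D' : diagram m l) :
  par_comp t (pbasis R D) (pbasis R D') =
    t ^+ alpha D D' *: pbasis R (star D D').
Proof.
rewrite /par_comp (bigD1 D) //= [X in _ + X]big1 ?addr0 => [|E /negbTE ne_ED].
  rewrite (bigD1 D') //= big1 ?addr0 => [|E /negbTE ne_ED].
    by rewrite !ffunE !eqxx !mul1r.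
  by rewrite !ffunE ne_ED mulr0 mul0r scale0r.
by rewrite big1 // => E' _; rewrite !ffunE ne_ED !mul0r scale0r.
Qed.

Lemma par_tens_pbasis m l m' l' (D : diagram m l) (D' : diagram m' l') :
  par_tens (pbasis R D) (pbasis R D') = pbasis R (juxtapose D D').
Proof.
rewrite /par_tens (bigD1 D) //= [X in _ + X]big1 ?addr0 => [|E /negbTE ne_ED].
  rewrite (bigD1 D') //= big1 ?addr0 => [|E /negbTE ne_ED].
    by rewrite !ffunE !eqxx mul1r scale1r.
  by rewrite !ffunE ne_ED mulr0 scale0r.
by rewrite big1 // => E' _; rewrite !ffunE ne_ED !mul0r scale0r.
Qed.

Lemma intertwined_all a b (f : par_hom R a b) : intertwined f.
Proof.
have -> : f = \sum_D f D *: pbasis R D.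
  apply/ffunP => D; rewrite sum_ffunE (bigD1 D) //= big1 => [|E /negbTE ne_ED].
    by rewrite !ffunE eqxx addr0 [RHS]mulr1.
  by rewrite !ffunE eq_sym ne_ED [LHS]mulr0.
apply: intertwined_sum => D;
  have [hmu hdelta heta heps hs] := intertwined_generators.
elim: (diagram_generated D) => {a b f D} //.
- exact: intertwined_id.
- move=> m l k D D' al0 _ hD _ hD'.
  (* As [alpha] vanishes, the stacked diagram is exactly the composite of the two basis
     morphisms. *)
  by have := intertwined_comp hD hD'; rewrite par_comp_pbasis al0 scale1r.
by move=> m l m' l' D D' _ hD _ hD'; rewrite -par_tens_pbasis;
  apply: intertwined_tens.
Qed.
End Naturality.

(** * The maps beta as isomorphisms of modules *)

Section Beta.
Variables (R : comPzRingType) (n : nat).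
Variable Theta : @linfunctor R (Heis R) (BiFam R) (@Theta_ob R).
Variable phi : forall a b, fhom (ftens (@Theta_ob R a) (@Theta_ob R b))
                                (@Theta_ob R (a ++ b)).
Hypothesis HTheta : is_Theta Theta phi.

Notation Th := (@Theta_ob R).
Notation wvec := (wvec phi).
Notation wmap := (wmap phi).

Lemma tbasis_ext k (V : lmodType R) (f g : {linear Vpow R n k -> V}) :
  (forall i, f (tbasis R i) = g (tbasis R i)) -> f =1 g.
Proof.
move=> fg v; rewrite (tbasis_sum v) (linear_sum f) (linear_sum g).
by apply: eq_bigr => i _; rewrite (linearZ_LR f) (linearZ_LR g) fg.
Qed.

Lemma spure_linl k x :
  linear (fun u : Th (ud k) n n => spure u x : Omega_ob R n k).
Proof. exact: tpure_linl. Qed.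

Lemma spure_ract k g (u : Th (ud k) n n) x :
  spure (ract _ g u) x = spure u x :> Omega_ob R n k.
Proof.
exact: (@tpure_act R unit (fun=> n) (fun=> Th (ud k) n n) (fun=> triv R n)
  (fun _ s => ract _ s) (fun _ s => sact (triv R n) s)).
Qed.

Definition spure1 k : {linear Th (ud k) n n -> Omega_ob R n k} :=
  HB.pack (fun u => @spure R n n (Th (ud k) n n) (triv R n) u (1 : R^o))
    (GRing.isLinear.Build _ _ _ _ _ (@spure_linl k (1 : R^o))).

Definition beta_map k : {linear Vpow R n k -> Omega_ob R n k} :=
  spure1 k \o wmap n k.

Lemma beta_map_wvec k (i : {ffun 'I_k -> 'I_n}) :
  beta_map k (tbasis R i) = spure1 k (wvec i).
Proof. by rewrite -wmap_tbasis. Qed.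

Lemma spure1_ract k g u : spure1 k (ract _ g u) = spure1 k u.
Proof. exact: spure_ract. Qed.

Lemma spureE k u (c : triv R n) : spure u c = (c : R^o) *: spure1 k u.
Proof.
have {1}-> : c = (c : R) *: (1 : R^o) by rewrite [RHS]mulr1.
rewrite -(linearZ_LR (spure1 k)); symmetry.
exact: (@tpure_scale R unit (fun=> n) (fun=> Th (ud k) n n) (fun=> triv R n)
  (fun _ s => ract _ s) (fun _ s => sact (triv R n) s)).
Qed.

Lemma beta_map_tbasis k (i : {ffun 'I_k -> 'I_n}) :
  beta_map k (tbasis R i) = beta_val R i.
Proof.
have [x xE] := beta_vecE HTheta 1%g i.
by rewrite /beta_val xE spure_ract invg1 lact1 beta_map_wvec.
Qed.

Lemma sact_tbasis k g (i : {ffun 'I_k -> 'I_n}) :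
  sact _ g (tbasis R i) = tbasis R [ffun p => g (i p)].
Proof.
apply/ffunP => j; rewrite !ffunE; congr (_ %:R); congr (nat_of_bool _).
apply/eqP/eqP => [<-|->]; apply/ffunP => p; rewrite !ffunE.
  by rewrite permKV.
by rewrite permK.
Qed.

(** The right factor in [lact_wvec] disappears in the tensor product with the trivial module. *)
Lemma beta_map_act k g (v : Vpow R n k) :
  beta_map k (sact _ g v) = sact _ g (beta_map k v).
Proof.
apply: (tbasis_ext (f := beta_map k \o sact (Vpow R n k) g)
                   (g := sact _ g \o beta_map k)) => i.
transitivity (beta_map k (tbasis R [ffun p => g (i p)])).
  by congr (beta_map k _); apply: sact_tbasis.
rewrite beta_map_wvec -(spure1_ract g) -lact_wvec
  -[RHS]/(sact _ g (beta_map k _)).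
by rewrite beta_map_wvec [RHS]stens_actE.
Qed.

Definition beta_shom k : shom (Vpow R n k) (Omega_ob R n k) :=
  SHom (@beta_map_act k).

Lemma beta_map_span k (P : Omega_ob R n k -> Prop) :
  P 0 -> (forall x y, P x -> P y -> P (x + y)) ->
  (forall c x, P x -> P (c *: x)) ->
  (forall i, P (beta_map k (tbasis R i))) -> forall x, P x.
Proof.
move=> P0 PD PZ P1; apply: tensor_ind => // -[] u c.
rewrite -[tpure _ _ _ _ _]/(spure u c) spureE.
apply: (PZ); move: u; apply: (wvec_span HTheta) => [|u v|x u|i g].
- by rewrite (linear0 (spure1 k)).
- by rewrite (linearD (spure1 k)); apply: PD.
- by rewrite (linearZ_LR (spure1 k)); apply: PZ.
by rewrite spure1_ract -beta_map_wvec.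
Qed.

Lemma beta_map_coef k :
  exists c : {ffun 'I_k -> 'I_n} -> {linear Omega_ob R n k -> R^o},
  forall j i, c j (beta_map k (tbasis R i)) = (i == j)%:R.
Proof.
suff /choice[c cE] : forall j, exists c : {linear Omega_ob R n k -> R^o},
    forall i, c (beta_map k (tbasis R i)) = (i == j)%:R by exists c.
move=> j.
have [f [fl fr fw]] := wvec_coef HTheta j.
exists (stens_lift fl fr) => i; rewrite beta_map_wvec.
by rewrite [LHS]stens_liftE mul1r.
Qed.

(** The dual functionals assemble into the inverse: [beta_map_coef] makes it a left inverse, and
    [beta_map_span] then makes it a right one. *)
Lemma beta_shom_iso k : @is_iso R (SMod R n) _ _ (beta_shom k).
Proof.
have [c cE] := beta_map_coef k.
pose L (x : Omega_ob R n k) : Vpow R n k := [ffun j => c j x] : vpow_mod R n k.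
have L_lin : linear L by move=> a x y; apply/ffunP => j; rewrite !ffunE linearP.
pose Ll : {linear Omega_ob R n k -> Vpow R n k} :=
  HB.pack L (GRing.isLinear.Build _ _ _ _ _ L_lin).
have LK : cancel (beta_map k) Ll.
  apply: (tbasis_ext (f := Ll \o beta_map k) (g := idfun)) => i.
  by apply/ffunP => j; rewrite !ffunE [LHS]cE eq_sym.
have KL : cancel Ll (beta_map k).
  apply: beta_map_span => [|x y hx hy|a x hx|i].
  - by rewrite !linear0.
  - by rewrite (linearD Ll) (linearD (beta_map k)) hx hy.
  - by rewrite (linearZ_LR Ll) (linearZ_LR (beta_map k)) hx.
  by rewrite LK.
have L_act g x : Ll (sact _ g x) = sact _ g (Ll x).
  by rewrite -{1}[x]KL -beta_map_act LK.
by exists (SHom L_act); split.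
Qed.
End Beta.

Theorem theorem5p1 (R : comPzRingType) (n : nat)
  (Psi : @linfunctor R (Par n%:R) (Heis_ud n%:R) (fun k => k))
  (HPsi : is_Psi Psi)
  (Theta : @linfunctor R (Heis R) (BiFam R) (@Theta_ob R))
  (phi : forall a b, fhom (ftens (@Theta_ob R a) (@Theta_ob R b))
                          (@Theta_ob R (a ++ b)))
  (HTheta : is_Theta Theta phi)
  (Omega : @linfunctor R (Heis_ud n%:R) (SMod R n) (@Omega_ob R n))
  (HOmega : is_Omega Theta Omega)
  (Phi : @linfunctor R (Par n%:R) (SMod R n) (@Vpow R n))
  (HPhi : is_Phi Phi) :
  exists beta : forall k : nat, shom (Vpow R n k) (Omega_ob R n k),
    (forall (k : nat) (i : {ffun 'I_k -> 'I_n}),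
       beta k (tbasis R i) = beta_val R i) /\
    natural_iso Phi Omega Psi beta.
Proof.
exists (beta_shom n phi); split=> [k i|]; first exact: (beta_map_tbasis HTheta).
split=> [a b f v|k]; last exact: (beta_shom_iso n HTheta).
rewrite [LHS](HOmega _ _ (Psi a b f)) [LHS]stens_funE.
by rewrite [X in spure X _](intertwined_all HPsi HTheta HPhi).
Qed.
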